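(* Let $A(z)=a_3z^3+a_2z^2+a_1z+a_0$ and $B(z)=b_3z^3+b_2z^2+b_1z+b_0$ be polynomials with complex coefficients (of degree at most three), and let $w$ be a positive weight function on $[0,2\pi]$ satisfying $$\frac{d}{d\theta}\left[A(e^{i\theta})w(\theta)\right]=B(e^{i\theta})w(\theta),\qquad 0\le\theta\le 2\pi,$$ and $A(1)[w(2\pi)-w(0)]=0$. Let $\widehat A,U_n,V_n,W_n,Y_n$ be the polynomials defined in the context. Then, for $n\ge3$, the reversed polynomial $\Phi_n^*$ of the associated monic orthogonal polynomial on the unit circle $\Phi_n$ satisfies $$\begin{aligned} \widehat A(z)(\Phi_n^* )''(z)&+\big\{(\widehat A)'(z)+Y_n(z)-\Theta(|W_n|)\widehat A(z)U_n(z)[zA(z)]^{-1}\big\}(\Phi_n^* )'(z)\\ &+\big\{\Theta(|W_n|)[V_n(z)W_n(z)-U_n(z)Y_n(z)][zA(z)]^{-1}+Y_n'(z)\big\}\Phi_n^*(z)=-W_n'(z)\Phi_n(z), \end{aligned}$$ where $\Theta$ is the unit step function with the convention $\Theta(0)=0$.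
   Context: Inner product: $\langle f,g\rangle=\int_0^{2\pi}f(e^{i\theta})\overline{g(e^{i\theta})}\,w(\theta)\,d\theta$. $\{\Phi_n\}_{n\ge0}$ is the sequence of monic orthogonal polynomials, $\deg\Phi_n=n$, $\langle\Phi_n,\Phi_m\rangle=0$ for $n\ne m$, written $\Phi_n(z)=z^n+\ell_{n,n-1}z^{n-1}+\cdots+\ell_{n,1}z+\ell_{n,0}$. The reversed polynomial is $\Phi_n^*(z)=z^n\overline{\Phi_n(1/\overline z)}$. Verblunsky coefficients: $\alpha_{n-1}=-\overline{\ell}_{n,0}=-\overline{\Phi_n(0)}$ for $n\ge1$, and $\alpha_{-1}=-1$. Prime denotes $d/dz$. The Pearson equation is understood with $\theta\mapsto A(e^{i\theta})w(\theta)$ absolutely continuous on $[0,2\pi]$ and the equation holding almost everywhere; $A(1)[w(2\pi)-w(0)]$ denotes the difference of the boundary values of $A(e^{i\theta})w(\theta)$ at $2\pi$ and $0$. Coefficients: $$\mathfrak{p}_{n,n}=(ib_3+2a_3)\overline{\alpha}_n,\quad \mathfrak{t}_{n,n}=(ib_3+a_3)\overline{\alpha}_{n+1}(1-|\alpha_n|^2)+(ib_2+a_2+a_3\ell_{n+1,n})\overline{\alpha}_n,$$ $$\mathfrak{s}_{n,n}=ib_1+(n+1)a_1-a_0\overline{\ell}_{n,n-1}-[ib_0+(n+1)a_0]\alpha_n\overline{\alpha}_{n-1},$$ $$\mathfrak{s}_{n,n+1}=na_2+a_3[(n-1)\ell_{n,n-1}-n\ell_{n+2,n+1}]+(ib_3+2a_3)\overline{\alpha}_n\alpha_{n-1}.$$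 Polynomials: $$\widehat{A}(z)=\overline{a}_0z^3+\overline{a}_1z^2+\overline{a}_2z+\overline{a}_3,$$ $$U_n(z)=na_3z^3+(\mathfrak{s}_{n,n+1}+na_3\overline{\alpha}_{n+1}\alpha_n)z^2+\mathfrak{s}_{n,n}z+ib_0+na_0,$$ $$V_n(z)=[ib_3-(n-2)a_3]\overline{\alpha}_nz^2-(\mathfrak{s}_{n,n+1}\overline{\alpha}_n+na_3\overline{\alpha}_{n+1}-\mathfrak{t}_{n,n})z+(ib_0+na_0)\overline{\alpha}_{n-1},$$ $$W_n(z)=(-i\overline{b}_0+n\overline{a}_0)\alpha_{n-1}z^2-(\overline{\mathfrak{s}}_{n,n+1}\alpha_n+n\overline{a}_3\alpha_{n+1}-\overline{\mathfrak{t}}_{n,n})z+\overline{\mathfrak{p}}_{n,n}-n\overline{a}_3\alpha_n,$$ $$Y_n(z)=(-i\overline{b}_0)z^2+(\overline{\mathfrak{s}}_{n,n}-n\overline{a}_1)z+\overline{\mathfrak{s}}_{n,n+1}+n\overline{a}_3\alpha_{n+1}\overline{\alpha}_n-n\overline{a}_2.$$ The factor $\Theta(|W_n|)$ equals $0$ if $W_n$ is the zero polynomial and $1$ otherwise. The equation is an identity of rational functions, valid at every $z$ with $zA(z)\neq0$. *)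

(* Defs.v *)
From HB Require Import structures.
From mathcomp Require Import all_boot all_order all_algebra.
From mathcomp Require Import all_classical all_reals all_analysis.
From mathcomp Require Import complex.

Set Implicit Arguments.
Unset Strict Implicit.
Unset Printing Implicit Defensive.

Import Order.TTheory GRing.Theory Num.Theory.
Import numFieldNormedType.Exports.

Local Open Scope classical_set_scope.
Local Open Scope ring_scope.

Definition expi (R : realType) (t : R) : R[i] := Complex (cos t) (sin t).

(** ** Complex-valued functions of a real variable *)

(* [R[i]] is not declared as a normed module over [R] in the library, so
   integrals and derivatives are taken on the real and imaginary parts. *)

Definition cintegral (R : realType) (a b : R) (F : R -> R[i]) : R[i] :=
  Complex (\int[lebesgue_measure]_(t in `[a, b]) complex.Re (F t))%R
          (\int[lebesgue_measure]_(t in `[a, b]) complex.Im (F t))%R.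

Definition is_cderive (R : realType) (t : R) (F : R -> R[i]) (d : R[i]) : Prop :=
  is_derive t 1 (fun u => complex.Re (F u)) (complex.Re d) /\
  is_derive t 1 (fun u => complex.Im (F u)) (complex.Im d).

(* The two inequalities below compare elements of [R] and of [R[i]]
   respectively: the norm of [R[i]] takes its (real) values in [R[i]]. *)
Definition absolutely_continuous_on (R : realType) (a b : R) (F : R -> R[i])
    : Prop :=
  forall eps : R, 0 < eps -> exists2 delta : R, 0 < delta &
    forall (m : nat) (s t : 'I_m -> R),
      (forall k, [/\ a <= s k, s k < t k & t k <= b]) ->
      trivIset setT (fun k => `]s k, t k[%classic) ->
      \sum_(k < m) (t k - s k) < delta ->
      \sum_(k < m) `|F (t k) - F (s k)| < eps%:C%C.

(** ** Orthogonal polynomials on the unit circle *)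

(* The weight may vanish on part of the circle (typically at zeros of [A]), but
   not almost everywhere. *)
Definition weight_function (R : realType) (w : R -> R) : Prop :=
  [/\ lebesgue_measure.-integrable `[0, 2 * pi] (EFin \o w),
      forall t : R, 0 <= t <= 2 * pi -> 0 <= w t
    & (0 < \int[lebesgue_measure]_(t in `[0%R, (2 * pi)%R]) (w t)%:E)%E].

Definition inner (R : realType) (w : R -> R) (f g : R[i] -> R[i]) : R[i] :=
  cintegral 0 (2 * pi) (fun t => f (expi t) * (g (expi t))^* * (w t)%:C%C).

Definition monic_orthogonal (R : realType) (w : R -> R) (Phi : nat -> {poly R[i]})
    : Prop :=
  [/\ forall n, size (Phi n) = n.+1,
      forall n, Phi n \is monic
    & forall n m, n <> m -> inner w (horner (Phi n)) (horner (Phi m)) = 0].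

(* [z ^ n] times the conjugate of [p.[1 / conj z]], for [p] of degree at most
   [n]; see [reversedE]. *)
Definition reversed (R : rcfType) (n : nat) (p : {poly R[i]}) : {poly R[i]} :=
  \poly_(k < n.+1) (p`_(n - k))^*.

Lemma reversedE (R : rcfType) (n : nat) (p : {poly R[i]}) (z : R[i]) :
  (size p <= n.+1)%N -> z != 0 ->
  (reversed n p).[z] = z ^+ n * (p.[1 / z^*])^*.
Proof.
move=> sp z0; rewrite horner_poly (horner_coef_wide _ sp) rmorph_sum mulr_sumr /=.
rewrite [RHS](reindex_inj rev_ord_inj) /=; apply: eq_bigr => k _.
rewrite subSS mul1r !rmorphM rmorphXn fmorphV /= conjCK mulrCA.
congr (_ * _); have kn : (k <= n)%N by rewrite -ltnS.
by rewrite exprVn -{2}(subnK kn) addnC exprD mulfK // expf_neq0.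
Qed.

(* [verblunsky Phi k] is [alpha_k] for [k >= 0]; the convention
   [alpha_(-1) = -1] is the value of the same formula at [Phi 0 = 1]. *)
Definition verblunsky (R : rcfType) (Phi : nat -> {poly R[i]}) (k : nat) : R[i] :=
  - ((Phi k.+1).[0])^*.

(** ** The Pearson equation *)

Definition pearson (R : realType) (w : R -> R) (A B : {poly R[i]}) : Prop :=
  let Aw t := A.[expi t] * (w t)%:C%C in
  absolutely_continuous_on 0 (2 * pi) Aw /\
  {ae lebesgue_measure, forall t, 0 <= t <= 2 * pi ->
    is_cderive t Aw (B.[expi t] * (w t)%:C%C)}.

(** ** Coefficients of the structure relations *)

Section Coefficients.
Variables (R : rcfType) (A B : {poly R[i]}) (Phi : nat -> {poly R[i]}).
Implicit Types n : nat.

Local Notation i := ('i%C : R[i]).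
Local Notation a j := (A`_j%N).
Local Notation b j := (B`_j%N).
Local Notation l n j := ((Phi n)`_j).
Local Notation alpha := (verblunsky Phi).

Definition coef_p n : R[i] := (i * b 3 + 2 * a 3) * (alpha n)^*.

Definition coef_t n : R[i] :=
  (i * b 3 + a 3) * (alpha n.+1)^* * (1 - `|alpha n| ^+ 2)
  + (i * b 2 + a 2 + a 3 * l n.+1 n) * (alpha n)^*.

(* [coef_s n] is s_(n,n) and [coef_s1 n] is s_(n,n+1). *)
Definition coef_s n : R[i] :=
  i * b 1 + (n%:R + 1) * a 1 - a 0 * (l n n.-1)^*
  - (i * b 0 + (n%:R + 1) * a 0) * alpha n * (alpha n.-1)^*.

Definition coef_s1 n : R[i] :=
  n%:R * a 2 + a 3 * ((n%:R - 1) * l n n.-1 - n%:R * l n.+2 n.+1)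
  + (i * b 3 + 2 * a 3) * (alpha n)^* * alpha n.-1.

Definition polyAhat : {poly R[i]} :=
  (a 0)^* *: 'X^3 + (a 1)^* *: 'X^2 + (a 2)^* *: 'X + ((a 3)^*)%:P.

Definition polyU n : {poly R[i]} :=
  (n%:R * a 3) *: 'X^3
  + (coef_s1 n + n%:R * a 3 * (alpha n.+1)^* * alpha n) *: 'X^2
  + coef_s n *: 'X + (i * b 0 + n%:R * a 0)%:P.

Definition polyV n : {poly R[i]} :=
  ((i * b 3 - (n%:R - 2) * a 3) * (alpha n)^*) *: 'X^2
  - (coef_s1 n * (alpha n)^* + n%:R * a 3 * (alpha n.+1)^* - coef_t n) *: 'X
  + ((i * b 0 + n%:R * a 0) * (alpha n.-1)^*)%:P.

Definition polyW n : {poly R[i]} :=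
  ((- i * (b 0)^* + n%:R * (a 0)^*) * alpha n.-1) *: 'X^2
  - ((coef_s1 n)^* * alpha n + n%:R * (a 3)^* * alpha n.+1
     - (coef_t n)^*) *: 'X
  + ((coef_p n)^* - n%:R * (a 3)^* * alpha n)%:P.

Definition polyY n : {poly R[i]} :=
  (- i * (b 0)^*) *: 'X^2 + ((coef_s n)^* - n%:R * (a 1)^*) *: 'X
  + ((coef_s1 n)^* + n%:R * (a 3)^* * alpha n.+1 * (alpha n)^*
     - n%:R * (a 2)^*)%:P.

End Coefficients.

(* The unit step of "the modulus of [W]": 0 if [W] is the zero polynomial, and 1
   otherwise (not evaluated pointwise at zeros of [W]). *)
Definition step (R : rcfType) (W : {poly R[i]}) : R[i] :=
  if W == 0 then 0 else 1.

(* Main.v *)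
(** The Pearson equation integrates by parts over the circle to
    <z A p', z^k> = <(i B + k A) p, z^k> for all polynomials p and k >= 0.
    With it, Q = z A Phi_n' - U_n Phi_n - V_n Phi_n^* is orthogonal to
    z, ..., z^(n+1), vanishes at 0 and has degree at most n + 1, whence Q = 0;
    the values of the inner products involved come from Szegő's recurrence.
    Reversing z A Phi_n' = U_n Phi_n + V_n Phi_n^* gives
    Ahat (Phi_n^* )' = - Y_n Phi_n^* - W_n Phi_n; the equation is the derivative
    of the latter, with W_n Phi_n' eliminated by means of the two relations.

    The integration by parts needs the fundamental theorem of calculus for
    absolutely continuous functions: subtracting an indefinite integral of the
    derivative leaves an absolutely continuous function with derivative 0 almost
    everywhere, which is constant by Cousin's lemma. *)
Require Import Defs.
From mathcomp Require Import all_boot all_order all_algebra.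
From mathcomp Require Import all_classical all_reals all_analysis.
From mathcomp Require Import complex ring lra zify.
Import Order.TTheory GRing.Theory Num.Theory.
Import numFieldNormedType.Exports.
Local Open Scope ring_scope.

Set Implicit Arguments.
Unset Strict Implicit.
Unset Printing Implicit Defensive.

(** * Integration by parts for absolutely continuous functions *)

Section AbsoluteContinuity.
Variable R : realType.
Implicit Types (a b : R) (f g h : R -> R).
Local Open Scope classical_set_scope.

(** The points [x] with [P a x] have a supremum; the local hypothesis there, glued to a nearby
    smaller point, gives [P] up to the supremum and then beyond it, unless [b] is reached. *)
Lemma cousin (P : R -> R -> Prop) a b : a <= b ->
  (forall x y z, a <= x -> x <= y -> y <= z -> z <= b -> P x y -> P y z -> P x z) ->
  (forall x, a <= x <= b -> exists2 r, 0 < r & forall u v,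
     a <= u -> u <= x -> x <= v -> v <= b -> x - r < u -> v < x + r -> P u v) ->
  P a b.
Proof.
move=> ab Padd Ploc; pose S := [set x | a <= x <= b /\ P a x].
have Sa : S a.
  split; first by rewrite lexx ab.
  have [|r r0 Pr] := Ploc a; first by rewrite lexx ab.
  by apply: Pr => //; rewrite ?ltrDl // ltrBlDr ltrDl.
have Sub : has_ubound S by exists b => x -[/andP[]].
have supS : has_sup S by split; [exists a|].
have aS : a <= sup S by exact: sup_upper_bound.
have Sb : sup S <= b by apply: ge_sup; [exists a|move=> x -[/andP[]]].
have [|r r0 Pr] := Ploc (sup S); first by rewrite aS Sb.
have [x [/andP[ax xb] Px] xr] := sup_adherent r0 supS.
have xS : x <= sup S by apply: sup_upper_bound => //; split => //;
  rewrite ax xb.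
have PS : P a (sup S).
  by apply: (Padd a x) => //; apply: Pr => //; rewrite ltrDl.
(* The step is [r / 2] because the local hypothesis reaches only points strictly below
   [sup S + r]. *)
have [Sr|rS] := leP b (sup S + r / 2).
  apply: (Padd a (sup S)) => //; apply: Pr => //.
    by rewrite ltrBlDr ltrDl.
  by rewrite (le_lt_trans Sr) // ltrD2l ltr_pdivrMr // ltr_pMr // ltr1n.
have : S (sup S + r / 2).
  split; first by rewrite (ltW rS) (le_trans aS) // lerDl divr_ge0 // ltW.
  apply: (Padd a (sup S)) => //; first by rewrite lerDl divr_ge0 // ltW.
    exact: ltW.
  apply: Pr => //; first by rewrite lerDl divr_ge0 // ltW.
  - exact: ltW.
  - by rewrite ltrBlDr ltrDl.
  by rewrite ltrD2l ltr_pdivrMr // ltr_pMr // ltr1n.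
by move=> /(sup_upper_bound supS); rewrite leNgt ltrDl divr_gt0.
Qed.

Definition chain a b (s : seq (R * R)) :=
  all (fun q => (a <= q.1) && (q.1 < q.2) && (q.2 <= b)) s
  && pairwise (fun p q => p.2 <= q.1) s.

Lemma chain1 a b x y : a <= x -> x < y -> y <= b -> chain a b [:: (x, y)].
Proof. by move=> ax xy yb; rewrite /chain /= ax xy yb. Qed.

Lemma chain_cat a b c s t : a <= b -> b <= c ->
  chain a b s -> chain b c t -> chain a c (s ++ t).
Proof.
move=> ab bc /andP[s1 s2] /andP[t1 t2];
  rewrite /chain all_cat pairwise_cat s2 t2 !andbT.
apply/andP; split.
  apply/andP; split.
    apply: sub_all s1 => q /andP[-> /=] qb; exact: le_trans bc.
  by apply: sub_all t1 => q /andP[/andP[bq ->] ->]; rewrite (le_trans ab).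
apply/allrelP => p q /(allP s1) /andP[_ pb] /(allP t1) /andP[/andP[bq _] _].
exact: le_trans bq.
Qed.

(* Absolute continuity on ordered lists of intervals, which concatenate. *)
Definition acr a b f := forall e, 0 < e -> exists2 d, 0 < d & forall s,
  chain a b s -> \sum_(q <- s) (q.2 - q.1) < d ->
  \sum_(q <- s) `|f q.2 - f q.1| < e.

(** Ordered intervals have disjoint interiors, so a chain indexed by its positions is an admissible
    family. *)
Lemma absolutely_continuous_on_chain a b (F : R -> R[i]) :
  absolutely_continuous_on a b F ->
  forall e, 0 < e -> exists2 d, 0 < d & forall s,
    chain a b s -> \sum_(q <- s) (q.2 - q.1) < d ->
    \sum_(q <- s) `|F q.2 - F q.1| < e%:C%C.
Proof.
move=> acF e e0; have [d d0 Fd] := acF _ e0; exists d => // s /andP[s1 s2] sd.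
pose x0 : R * R := (a, a); pose q (k : 'I_(size s)) := nth x0 s k.
have /= := Fd (size s) (fun k => (q k).1) (fun k => (q k).2).
rewrite (big_nth x0) big_mkord; apply.
- move=> k; have /(allP s1) : q k \in s by exact: mem_nth.
  by move=> /andP[/andP[]].
- have lt (j k : 'I_(size s)) : (j < k)%N -> (q j).2 <= (q k).1.
    by move=> jk; have /(pairwiseP x0) := s2; apply; rewrite ?inE ?ltn_ord.
  move=> j k _ _ [x /=]; rewrite !in_itv /= => -[/andP[jx xj] /andP[kx xk]].
  apply: val_inj => /=; case: (ltngtP j k) => // [/lt|/lt] l.
    by have := lt_trans kx xj; rewrite ltNge l.
  by have := lt_trans jx xk; rewrite ltNge l.
by move: sd; rewrite (big_nth x0) big_mkord.
Qed.

Lemma normc_ge_Im (x : R[i]) : `|complex.Im x|%:C%C <= `|x|.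
Proof.
rewrite -[leRHS]mul1r -(_ : `|'i%C : R[i]| = 1); last first.
  by rewrite normc_def /= expr0n expr1n add0r sqrtr1.
rewrite -normrM mulrC -[complex.Im x]opprK normrN -ReiNIm.
exact: normc_ge_Re.
Qed.

Lemma acr_Re a b F : absolutely_continuous_on a b F ->
  acr a b (fun t => complex.Re (F t)).
Proof.
move=> acF e e0; have [d d0 Fd] := absolutely_continuous_on_chain acF e0.
exists d => // s cs sd; rewrite -ltcR; apply: le_lt_trans (Fd s cs sd).
rewrite rmorph_sum /=; apply: ler_sum => q _.
by rewrite -raddfB; exact: normc_ge_Re.
Qed.

Lemma acr_Im a b F : absolutely_continuous_on a b F ->
  acr a b (fun t => complex.Im (F t)).
Proof.
move=> acF e e0; have [d d0 Fd] := absolutely_continuous_on_chain acF e0.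
exists d => // s cs sd; rewrite -ltcR; apply: le_lt_trans (Fd s cs sd).
rewrite rmorph_sum /=; apply: ler_sum => q _.
by rewrite -raddfB; exact: normc_ge_Im.
Qed.

(** Boundedness passes to unions of adjacent intervals, and near [x] absolute continuity on one
    short interval keeps [f] within 1 of [f x]; Cousin's lemma concludes. *)
Lemma acr_bounded a b f : a <= b -> acr a b f ->
  exists N, forall t, a <= t <= b -> `|f t| <= N.
Proof.
move=> ab /(_ 1 ltr01)[d d0 fd].
apply: (cousin (P := fun u v => exists N, forall t, u <= t <= v -> `|f t| <= N)) ab _ _.
  move=> x y z _ _ _ _ [N fN] [M fM]; exists (Num.max N M) => t /andP[xt tz].
  rewrite le_max; have [ty|yt] := leP t y; first by rewrite fN ?xt.
  by rewrite fM ?orbT // tz ltW.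
move=> x /andP[ax xb]; exists d => // u v au ux xv vb ud vd.
exists (1 + `|f x|) => t /andP[ut tv]; rewrite -lerBlDr.
rewrite (le_trans (lerB_dist _ _)) //.
have [tx|xt|->] := ltgtP t x; last by rewrite subrr normr0 ler01.
- have := fd [:: (t, x)]; rewrite !big_seq1 /= distrC => /(_ _ _)/ltW; apply.
    by apply: chain1 => //; exact: le_trans ut.
  by rewrite ltrBlDr -ltrBlDl (lt_le_trans ud).
- have := fd [:: (x, t)]; rewrite !big_seq1 /= => /(_ _ _)/ltW; apply.
    by apply: chain1 => //; exact: le_trans vb.
  by rewrite ltrBlDl (le_lt_trans tv).
Qed.

(** An increment of the product is [h] times an increment of [f] plus an increment of [h] times [f];
    boundedness controls the first sum, the Lipschitz condition the second, each by [e / 2]. *)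
Lemma acr_mul a b f h L M : a <= b -> acr a b f ->
  (forall t, a <= t <= b -> `|h t| <= M) ->
  (forall s t, a <= s -> s <= t -> t <= b -> `|h t - h s| <= L * (t - s)) ->
  acr a b (fun t => h t * f t).
Proof.
move=> ab acf hM hL e e0; have [N fN] := acr_bounded ab acf.
have M0 : 0 <= M by apply: le_trans (hM a _); rewrite ?lexx ?ab.
have N0 : 0 <= N by apply: le_trans (fN a _); rewrite ?lexx ?ab.
pose K := `|L| * N + 1; have K0 : 0 < K by rewrite ltr_wpDl // mulr_ge0.
have M1 : 0 < M + 1 by rewrite ltr_wpDl.
have [|d d0 fd] := acf (e / 2 / (M + 1)); first by rewrite !divr_gt0.
exists (Num.min d (e / 2 / K)); first by rewrite lt_min d0 !divr_gt0.
move=> s cs; rewrite lt_min => /andP[sd sK].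
have := fd s cs sd; rewrite ltr_pdivlMr // => sf.
move: sK; rewrite ltr_pdivlMr // => sK.
rewrite [e]splitr; apply: le_lt_trans (ltrD sf sK).
rewrite !mulr_suml -big_split /= !big_seq; apply: ler_sum => q qs.
have /andP[/allP/(_ q qs) /andP[/andP[aq q12] qb] _] := cs.
have -> : h q.2 * f q.2 - h q.1 * f q.1 =
  h q.2 * (f q.2 - f q.1) + (h q.2 - h q.1) * f q.1 by ring.
rewrite (le_trans (ler_normD _ _)) // !normrM lerD //.
  rewrite mulrC ler_wpM2l // (@le_trans _ _ M) ?lerDl // hM //.
  by rewrite qb (le_trans aq) // ltW.
apply: (@le_trans _ _ ((`|L| * (q.2 - q.1)) * N)).
  apply: ler_pM => //; last by rewrite fN // aq (le_trans _ qb) // ltW.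
  rewrite (le_trans (hL _ _ _ _ _)) ?(ltW q12) // ler_wpM2r ?ler_norm //.
  by rewrite subr_ge0 ltW.
rewrite mulrAC mulrC ler_wpM2l ?lerDl // subr_ge0; exact: ltW.
Qed.

End AbsoluteContinuity.

(** * The fundamental theorem of calculus for absolutely continuous functions *)

Section FundamentalTheorem.
Variable R : realType.
Implicit Types (a b : R) (f g h : R -> R).
Local Open Scope classical_set_scope.
Local Notation mu := (@lebesgue_measure R).

(** First-order expansion with the division cleared, so that it also covers [y = x]. *)
Lemma is_derive_approx f (x d : R) : is_derive x 1 f d ->
  forall e, 0 < e -> exists2 r, 0 < r & forall y, `|y - x| < r ->
    `|f y - f x - d * (y - x)| <= e * `|y - x|.
Proof.
move=> [df <-] e e0; have /cvgrPdist_le /(_ e e0) := df.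
rewrite near_withinE => /nbhs_ballP[r /= r0 Hr]; exists r => // y yr.
have [->|yx] := eqVneq y x; first by rewrite !subrr mulr0 subrr normr0 mulr0.
have yx0 : y - x != 0 by rewrite subr_eq0.
have := Hr (y - x); rewrite /ball /= sub0r normrN => /(_ yr yx0).
rewrite [_%:A]mulr1 subrK -/(derive f x 1) -(ler_pM2r (x := `|y - x|)) ?normr_gt0 //.
rewrite -normrM mulrBl -scalerAl mulrC; set D := 'D_1 f x.
rewrite [(f y - f x) * _]mulrC scalerA mulVf // scale1r distrC [_ * D]mulrC;
  exact.
Qed.

Lemma Rintegral_setI_itv (O : set R) a u v k : measurable O ->
  mu.-integrable `]a, v] (EFin \o k) -> a <= u -> u <= v ->
  \int[mu]_(t in O `&` `]a, v]) k t - \int[mu]_(t in O `&` `]a, u]) k t =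
  \int[mu]_(t in O `&` `]u, v]) k t.
Proof.
move=> mO ik au uv.
have -> : O `&` `]a, v] = (O `&` `]a, u]) `|` (O `&` `]u, v]).
  rewrite -setIUr; congr (_ `&` _);
    rewrite [LHS](@itv_bndbnd_setU _ _ _ (BRight u)) //.
rewrite Rintegral_setU; first by rewrite [LHS]addrC addKr.
- exact: measurableI.
- exact: measurableI.
- apply: integrableS ik => //; first by apply: measurableU; exact: measurableI.
  rewrite -setIUr => t [_ [|]] /=; rewrite !in_itv /= => /andP[at1 tb].
    by rewrite at1 (le_trans tb).
  by rewrite tb (le_lt_trans au).
- apply/disj_setPS => t [[_ +] [_]] /=;
  rewrite !in_itv /= => /andP[_ tu] /andP[ut _].
  by have := lt_le_trans ut tu; rewrite ltxx.
Qed.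

(* On an open set [O] of small measure containing the exceptional null set the
   increments of [f - G] are controlled by absolute continuity, elsewhere by the
   vanishing derivative; Cousin's lemma glues the two. *)
Lemma acr_ftc a b f g : a <= b -> acr a b f ->
  mu.-integrable `[a, b] (EFin \o g) ->
  {ae mu, forall t, a <= t <= b -> is_derive t 1 f (g t)} ->
  \int[mu]_(t in `[a, b]) g t = f b - f a.
Proof.
move=> ab acf ig df; pose g0 := g \_ `[a, b].
have ig0 : mu.-integrable setT (EFin \o g0).
  have /integrable_mkcond := ig; rewrite restrict_EFin; apply.
  exact: measurable_itv.
have igS D : measurable D -> mu.-integrable D (EFin \o g0).
  by move=> mD; exact: integrableS ig0.
have ing0 D : measurable D -> mu.-integrable D (EFin \o (fun t => `|g0 t|)).
  by move=> mD; apply: integrable_norm; exact: igS.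
(* As [g0] is zero outside the interval, its integral from minus infinity is an indefinite integral
   of [g], differentiable almost everywhere. *)
pose G x := \int[mu]_(t in `]-oo, x]) g0 t.
have dG : {ae mu, forall x, derivable G x 1 /\ G^`() x = g0 x}.
  by apply: FTC1Ny => [y|]; [exact: igS|exact: integrable_locally].
have Gsub u v : u <= v -> G v - G u = \int[mu]_(t in `]u, v]) g0 t.
  by move=> uv; rewrite /G Rintegral_itvB //; exact: igS.
suff : f b - f a = G b - G a.
  move=> ->; rewrite Gsub // Rintegral_itv_obnd_cbnd; last exact: igS.
  by apply: eq_Rintegral => t tab; rewrite /g0 patchE tab.
have [M [mM M0 bad]] := negligibleU df dG.
have good x : ~ M x -> a <= x <= b -> is_derive x 1 f (g x) /\ is_derive x 1 G (g x).
  move=> nMx xab.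
  have [fx Gx] : (a <= x <= b -> is_derive x 1 f (g x)) /\
      (derivable G x 1 /\ G^`() x = g0 x).
    by apply: contrapT => nP; apply: nMx; apply: bad; rewrite -setCI.
  split; first exact: fx.
  have [Gd GE] := Gx; apply: DeriveDef => //; rewrite -derive1E GE /g0 patchE.
  by rewrite mem_set //= in_itv.
apply/eqP; rewrite -subr_eq0 -normr_le0.
have b2 : 0 < b - a + 2 by rewrite ltr_wpDl // subr_ge0.
(* The term [e * (b - a)] comes from the points of differentiability; one further [e] bounds the
   variation of [f] over the exceptional intervals, the other that of [G]. *)
suff key e : 0 < e -> `|f b - f a - (G b - G a)| <= e * (b - a) + (e + e).
  apply/ler_addgt0Pr => e e0; have := key (e / (b - a + 2)) (divr_gt0 e0 b2).
  rewrite add0r => /le_trans; apply; rewrite le_eqVlt; apply/orP; left;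
    apply/eqP.
  by field; rewrite gt_eqF.
move=> e0; have [d1 d10 F1] := acf e e0.
have [d2 [d20 F2]] := integral_normr_continuous ig0 e0.
have d0 : 0 < Num.min d1 d2 by rewrite lt_min d10.
have [|O [oO MO Od]] := lebesgue_regularity_outer mM _ d0; first by rewrite M0.
have mO : measurable O := measurable_realfun.open_measurable oO.
(* Regularity bounds the measure of [O] minus [M]; as [M] is null, the bound holds for [O]. *)
have muO : (mu O < (Num.min d1 d2)%:E)%E.
  rewrite (measureDI mu mO mM) [X in (_ + X)%E](_ : _ = 0%E) ?adde0 //.
  by apply: subset_measure0 M0 => //; exact: measurableI.
have i1 x : mu.-integrable `]a, x] (EFin \o (fun=> 1 : R)).
  apply: measurable_bounded_integrable => //=.
    by rewrite lebesgue_measure_itv; case: ifP => _;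
      rewrite ?ltry // -EFinD ltry.
  exact: bounded_cst.
(* Increments of [V] add up over adjacent intervals: for the constant 1 they measure the part of [O]
   in the interval, for the modulus of [g0] they bound the variation of [G] when the interval lies
   in [O]. *)
pose V (k : R -> R) (x : R) := \int[mu]_(t in O `&` `]a, x]) k t.
have Vsub k u v : (forall x, mu.-integrable `]a, x] (EFin \o k)) ->
    a <= u -> u <= v -> V k v - V k u = \int[mu]_(t in O `&` `]u, v]) k t.
  by move=> ik au uv; exact: Rintegral_setI_itv.
have ing x : mu.-integrable `]a, x] (EFin \o (fun t => `|g0 t|)) by exact: ing0.
pose P u v := exists2 s, chain u v s &
  \sum_(q <- s) (q.2 - q.1) <= V (fun=> 1) v - V (fun=> 1) u /\
  `|f v - f u - (G v - G u)| <= e * (v - u) + \sum_(q <- s) `|f q.2 - f q.1|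
    + (V (fun t => `|g0 t|) v - V (fun t => `|g0 t|) u).
have : P a b.
  apply: cousin ab _ _.
    move=> x y z ax xy yz zb [s cs [ls fs]] [t ct [lt ft]].
    exists (s ++ t); first exact: (chain_cat xy yz).
    rewrite !big_cat /=; split; first by lra.
    have -> : f z - f x - (G z - G x) =
      (f y - f x - (G y - G x)) + (f z - f y - (G z - G y)) by ring.
    by apply: le_trans (ler_normD _ _) _; lra.
  (* Near a point of [M] the interval lies in [O] and is itself the chain, unless degenerate; near
     any other point the chain is empty. *)
  move=> x /andP[ax xb]; have [Mx|nMx] := pselect (M x).
    have /nbhs_ballP[r /= r0 Br] : nbhs x O by apply: open_nbhs_nbhs;
      split => //; exact: MO.
    exists r => // u v au ux xv vb ru rv.
    have [uv|uv] := eqVneq u v.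
      by exists [::] => //; rewrite !big_nil uv !subrr mulr0 normr0 !addr0.
    have {}uv : u < v by rewrite lt_neqAle uv (le_trans ux).
    have OI : O `&` `]u, v] = `]u, v].
      apply/setIidr => t; rewrite /= in_itv /= => /andP[ut tv]; apply: Br.
      by rewrite /ball /= ltr_norml; apply/andP; split; lra.
    exists [:: (u, v)]; first exact: chain1.
    have muE : mu `]u, v] = (v - u)%:E.
      by have := lebesgue_measure_itv (Interval (BRight u) (BRight v));
        rewrite /= lte_fin uv -EFinD.
    have uv' := ltW uv.
    rewrite !big_seq1 /= (Vsub _ _ _ i1) // (Vsub _ _ _ ing) // OI; split.
      by rewrite Rintegral_cst // mul1r -[leLHS]/(fine (v - u)%:E) -muE lexx.
    have := @le_normr_Rintegral _ _ _ mu `]u, v] g0 (measurable_itv _) (igS _ (measurable_itv _)).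
    rewrite -Gsub ?(ltW uv) // => Gle.
    apply: le_trans (ler_normB _ _) _; rewrite lerD //.
    by rewrite lerDr mulr_ge0 ?subr_ge0 // ltW.
  have [|fx Gx] := good x nMx; first by rewrite ax.
  have e2 : 0 < e / 2 by rewrite divr_gt0.
  have [r1 r10 f1] := is_derive_approx fx e2.
  have [r2 r20 f2] := is_derive_approx Gx e2.
  exists (Num.min r1 r2); first by rewrite lt_min r10.
  move=> u v au ux xv vb; rewrite ltrBlDr -ltrBlDl lt_min => /andP[ru1 ru2].
  rewrite -ltrBlDl lt_min => /andP[rv1 rv2].
  have uv := le_trans ux xv.
  exists [::] => //; rewrite !big_nil addr0 (Vsub _ _ _ i1) // (Vsub _ _ _ ing) //.
  split; first exact: Rintegral_ge0.
  rewrite -[leLHS]addr0 lerD //; last exact: Rintegral_ge0.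
  have xv' : `|v - x| = v - x by rewrite ger0_norm // subr_ge0.
  have xu' : `|u - x| = x - u by rewrite distrC ger0_norm // subr_ge0.
  have := f1 v; have := f2 v; have := f1 u; have := f2 u; rewrite xv' xu'.
  move=> /(_ ru2) h1 /(_ ru1) h2 /(_ rv2) h3 /(_ rv1) h4.
  (* Both functions are compared with the same slope [g x] at [u] and at [v]; the four errors of
     rate [e / 2] add up to [e * (v - u)]. *)
  have -> : f v - f u - (G v - G u) = ((f v - f x - g x * (v - x))
     - (G v - G x - g x * (v - x))) - ((f u - f x - g x * (u - x))
     - (G u - G x - g x * (u - x))) by ring.
  apply: le_trans (ler_normB _ _) _.
  have := ler_normB (f v - f x - g x * (v - x)) (G v - G x - g x * (v - x)).
  have := ler_normB (f u - f x - g x * (u - x)) (G u - G x - g x * (u - x)).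
  by lra.
move=> [s cs [ls fs]].
rewrite (Vsub _ _ _ i1) // in ls; rewrite (Vsub _ _ _ ing) // in fs.
(* The length of the chain is at most the measure of this set, which is below both thresholds:
   absolute continuity of [f] and of the integral each cost at most [e]. *)
have mI : measurable (O `&` `]a, b]) by exact: measurableI.
have muI : (mu (O `&` `]a, b]) < (Num.min d1 d2)%:E)%E.
  by apply: le_lt_trans muO; apply: le_measure; rewrite ?inE.
have finI : mu (O `&` `]a, b]) \is a fin_num.
  by rewrite ge0_fin_numE // (lt_trans muI) // ltry.
apply: (le_trans fs); rewrite -addrA lerD2l lerD //; apply: ltW.
  apply: F1 => //; apply: (le_lt_trans ls).
  rewrite Rintegral_cst // mul1r -lte_fin fineK //; apply: (lt_le_trans muI).
  by rewrite lee_fin ge_min lexx.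
apply: F2 => //; apply: (lt_le_trans muI).
by rewrite lee_fin ge_min lexx orbT.
Qed.

End FundamentalTheorem.

(** * Derivatives and integrals of complex-valued functions *)

Section ComplexCalculus.
Variable R : realType.
Implicit Types (F G : R -> R[i]) (t : R) (p : {poly R[i]}).
Local Open Scope classical_set_scope.
Local Notation mu := (@lebesgue_measure R).

Lemma ReD (x y : R[i]) : complex.Re (x + y) = complex.Re x + complex.Re y.
Proof. by case: x y => [? ?] [? ?]. Qed.

Lemma ImD (x y : R[i]) : complex.Im (x + y) = complex.Im x + complex.Im y.
Proof. by case: x y => [? ?] [? ?]. Qed.

Lemma ReM (x y : R[i]) :
  complex.Re (x * y) = complex.Re x * complex.Re y - complex.Im x * complex.Im y.
Proof. by case: x y => [? ?] [? ?]. Qed.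

Lemma ImM (x y : R[i]) :
  complex.Im (x * y) = complex.Re x * complex.Im y + complex.Im x * complex.Re y.
Proof. by case: x y => [? ?] [? ?]. Qed.

Lemma ReJ (x : R[i]) : complex.Re x^* = complex.Re x.
Proof. by case: x. Qed.

Lemma ImJ (x : R[i]) : complex.Im x^* = - complex.Im x.
Proof. by case: x. Qed.

Lemma is_cderiveD t F G (d e : R[i]) : is_cderive t F d -> is_cderive t G e ->
  is_cderive t (fun u => F u + G u) (d + e).
Proof.
move=> [F1 F2] [G1 G2]; split.
  rewrite ReD (_ : (fun _ => _) = (fun u => complex.Re (F u)) + (fun u => complex.Re (G u))).
    exact: is_deriveD.
  by apply/funext => u; rewrite ReD.
rewrite ImD (_ : (fun _ => _) = (fun u => complex.Im (F u)) + (fun u => complex.Im (G u))).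
  exact: is_deriveD.
by apply/funext => u; rewrite ImD.
Qed.

Lemma is_cderiveM t F G (d e : R[i]) : is_cderive t F d -> is_cderive t G e ->
  is_cderive t (fun u => F u * G u) (d * G t + F t * e).
Proof.
move=> [F1 F2] [G1 G2]; split.
  rewrite (_ : (fun _ => _) = (fun u => complex.Re (F u)) * (fun u => complex.Re (G u))
      - (fun u => complex.Im (F u)) * (fun u => complex.Im (G u))); last first.
    by apply/funext => u; rewrite ReM.
  apply: is_derive_eq; rewrite ReD !ReM /GRing.scale /=; ring.
rewrite (_ : (fun _ => _) = (fun u => complex.Re (F u)) * (fun u => complex.Im (G u))
    + (fun u => complex.Im (F u)) * (fun u => complex.Re (G u))); last first.
  by apply/funext => u; rewrite ImM.
apply: is_derive_eq; rewrite ImD !ImM /GRing.scale /=; ring.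
Qed.

Lemma is_cderive_cst t (c : R[i]) : is_cderive t (fun=> c) 0.
Proof. by split; exact: is_derive_cst. Qed.

Lemma is_cderive_conj t F (d : R[i]) : is_cderive t F d ->
  is_cderive t (fun u => (F u)^*) d^*.
Proof.
move=> [F1 F2]; split.
  by rewrite ReJ (_ : (fun _ => _) = (fun u => complex.Re (F u))) //;
    apply/funext => u; rewrite ReJ.
rewrite ImJ (_ : (fun _ => _) = - (fun u => complex.Im (F u))).
  exact: is_deriveN.
by apply/funext => u; rewrite ImJ.
Qed.

Lemma is_cderive_expi t : is_cderive t (@expi R) ('i%C * expi t).
Proof.
by split; rewrite /expi /= !(mul0r, mul1r, sub0r, add0r);
  [exact: is_derive_cos|exact: is_derive_sin].
Qed.

Lemma is_cderive_horner t p :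
  is_cderive t (fun u => p.[expi u]) (p^`().[expi t] * ('i%C * expi t)).
Proof.
elim/poly_ind: p => [|p c IH].
  rewrite deriv0 horner0 mul0r (_ : (fun _ => _) = fun=> 0).
    exact: is_cderive_cst.
  by apply/funext => u; rewrite horner0.
rewrite (_ : (fun u => _) = fun u => p.[expi u] * expi u + c); last first.
  by apply/funext => u; rewrite hornerMXaddC.
have := is_cderiveD (is_cderiveM IH (is_cderive_expi t)) (is_cderive_cst t c).
rewrite derivMXaddC hornerD hornerM hornerX.
by congr is_cderive; ring.
Qed.

Definition ccontinuous F :=
  continuous (fun t => complex.Re (F t)) /\ continuous (fun t => complex.Im (F t)).

Lemma is_cderive_ccontinuous F (dF : R -> R[i]) :
  (forall t, is_cderive t F (dF t)) -> ccontinuous F.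
Proof.
by move=> dFE; split=> t; have [[d1 _] [d2 _]] := dFE t;
  apply/differentiable_continuous/derivable1_diffP.
Qed.

Definition cintegrable (a b : R) F :=
  mu.-integrable `[a, b] (EFin \o (fun t => complex.Re (F t))) /\
  mu.-integrable `[a, b] (EFin \o (fun t => complex.Im (F t))).

Lemma continuous_bounded_itv (a b : R) (h : R -> R) : continuous h ->
  exists M, forall x, M < x -> forall t, a <= t <= b -> `|h t| <= x.
Proof.
move=> ch; have : compact (h @` `[a, b]).
  by apply: continuous_compact;
    [exact: continuous_subspaceT|exact: segment_compact].
move=> /compact_bounded [M [Mr HM]]; exists M => x Mx t tab.
by apply: (HM x Mx); exists t => //=; rewrite in_itv.
Qed.

Lemma integrable_continuousM (a b : R) (f h : R -> R) : a <= b -> continuous h ->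
  mu.-integrable `[a, b] (EFin \o f) ->
  mu.-integrable `[a, b] (EFin \o (fun t => h t * f t)).
Proof.
move=> ab ch intf.
have -> : EFin \o (fun t => h t * f t) = ((EFin \o f) \* (EFin \o h))%E.
  by apply/funext => t /=; rewrite -EFinM mulrC.
apply: integrableMl => //.
  by apply: measurable_funS (measurable_realfun.continuous_measurable_fun ch).
have [M HM] := continuous_bounded_itv a b ch.
exists M; split => [|x Mx t /= tab]; first exact: num_real.
by apply: HM => //; rewrite in_itv in tab.
Qed.

Lemma cintegrableM (a b : R) F G : a <= b -> ccontinuous F -> cintegrable a b G ->
  cintegrable a b (fun t => F t * G t).
Proof.
move=> ab [F1 F2] [G1 G2]; split.
  rewrite (_ : EFin \o _ = (EFin \o (fun t => (complex.Re (F t) * complex.Re (G t))%R))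
     \- (EFin \o (fun t => (complex.Im (F t) * complex.Im (G t))%R)))%E;
       last first.
    by apply/funext => t /=; rewrite ReM EFinB.
  by apply: integrableB => //; exact: integrable_continuousM.
rewrite (_ : EFin \o _ = (EFin \o (fun t => (complex.Re (F t) * complex.Im (G t))%R))
   \+ (EFin \o (fun t => (complex.Im (F t) * complex.Re (G t))%R)))%E;
     last first.
  by apply/funext => t /=; rewrite ImM EFinD.
by apply: integrableD => //; exact: integrable_continuousM.
Qed.

Lemma cintegralD (a b : R) F G : cintegrable a b F -> cintegrable a b G ->
  cintegral a b (fun t => F t + G t) = cintegral a b F + cintegral a b G.
Proof.
move=> [F1 F2] [G1 G2]; rewrite /cintegral.
have -> : \int[mu]_(t in `[a, b]) complex.Re (F t + G t) =
  \int[mu]_(t in `[a, b]) (complex.Re (F t) + complex.Re (G t)).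
  by apply: eq_Rintegral => t _; rewrite ReD.
have -> : \int[mu]_(t in `[a, b]) complex.Im (F t + G t) =
  \int[mu]_(t in `[a, b]) (complex.Im (F t) + complex.Im (G t)).
  by apply: eq_Rintegral => t _; rewrite ImD.
by rewrite !RintegralD.
Qed.

Lemma cintegralZ (a b : R) (c : R[i]) F : cintegrable a b F ->
  cintegral a b (fun t => c * F t) = c * cintegral a b F.
Proof.
move=> [F1 F2]; rewrite /cintegral.
have iZ (r : R) (f : R -> R) : mu.-integrable `[a, b] (EFin \o f) ->
    mu.-integrable `[a, b] (EFin \o (fun t => r * f t)).
  move=> intf; rewrite (_ : EFin \o _ = (fun t => r%:E * (EFin \o f) t)%E) //.
  by apply: integrableZl => //; exact: measurable_itv.
have -> : \int[mu]_(t in `[a, b]) complex.Re (c * F t) =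
  \int[mu]_(t in `[a, b]) (complex.Re c * complex.Re (F t) - complex.Im c * complex.Im (F t)).
  by apply: eq_Rintegral => t _; rewrite ReM.
have -> : \int[mu]_(t in `[a, b]) complex.Im (c * F t) =
  \int[mu]_(t in `[a, b]) (complex.Re c * complex.Im (F t) + complex.Im c * complex.Re (F t)).
  by apply: eq_Rintegral => t _; rewrite ImM.
rewrite RintegralB ?RintegralD ?RintegralZl //; try exact: iZ.
by case: c.
Qed.

Lemma cintegral_conj (a b : R) F : cintegrable a b F ->
  cintegral a b (fun t => (F t)^*) = (cintegral a b F)^*.
Proof.
move=> [F1 F2]; rewrite /cintegral.
have -> : \int[mu]_(t in `[a, b]) complex.Re (F t)^* =
  \int[mu]_(t in `[a, b]) complex.Re (F t).
  by apply: eq_Rintegral => t _; rewrite ReJ.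
have -> : \int[mu]_(t in `[a, b]) complex.Im (F t)^* =
  \int[mu]_(t in `[a, b]) (-1 * complex.Im (F t)).
  by apply: eq_Rintegral => t _; rewrite ImJ mulN1r.
by rewrite RintegralZl // mulN1r.
Qed.

End ComplexCalculus.

(** * Integration by parts, real and complex *)

Section IntegrationByParts.
Variable R : realType.
Local Open Scope classical_set_scope.
Local Notation mu := (@lebesgue_measure R).

(** The fundamental theorem is applied to [h * f], absolutely continuous because [h] is Lipschitz by
    the mean value theorem. Integrability is returned as well, since the complex version splits
    integrals. *)
Lemma acr_ibp (a b : R) (f g h h' : R -> R) : a <= b -> acr a b f ->
  mu.-integrable `[a, b] (EFin \o f) -> mu.-integrable `[a, b] (EFin \o g) ->
  {ae mu, forall t, a <= t <= b -> is_derive t 1 f (g t)} ->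
  (forall t : R, is_derive t 1 h (h' t)) -> continuous h' ->
  mu.-integrable `[a, b] (EFin \o (fun t => h' t * f t + h t * g t)) /\
  \int[mu]_(t in `[a, b]) (h' t * f t + h t * g t) = h b * f b - h a * f a.
Proof.
move=> ab acf intf intg df dh ch'.
have ch : continuous h.
  by move=> t; have [d _] := dh t;
    apply/differentiable_continuous/derivable1_diffP.
have int : mu.-integrable `[a, b] (EFin \o (fun t => h' t * f t + h t * g t)).
  rewrite (_ : EFin \o _ = (EFin \o (fun t => (h' t * f t)%R))
      \+ (EFin \o (fun t => (h t * g t)%R)))%E; last first.
    by apply/funext => t /=; rewrite EFinD.
  by apply: integrableD => //; exact: integrable_continuousM.
split=> //; have [M HM] := continuous_bounded_itv a b ch.
have [L HL] := continuous_bounded_itv a b ch'.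
apply: (acr_ftc (f := fun t => h t * f t)) => //.
  apply: (acr_mul (L := L + 1) (M := M + 1)) => //.
    by move=> t tab; apply: HM tab; rewrite ltrDl.
  move=> s t as_ st tb.
  have [|u ust ->] := MVT_segment st (fun x _ => dh x);
    first exact: continuous_subspaceT.
  rewrite normrM (ger0_norm (_ : 0 <= t - s)) ?subr_ge0 //.
  rewrite ler_wpM2r ?subr_ge0 //; move: ust; rewrite in_itv /= => /andP[su ut].
  by apply: HL; rewrite ?ltrDl // (le_trans as_ su) (le_trans ut tb).
move: df; apply: filterS; first exact: (ae_filter_ringOfSetsType mu).
move=> t dft tab.
have ft := dft tab; have ht := dh t.
rewrite (_ : (fun _ => _) = (h * f)) //.
by apply: is_derive_eq; rewrite /GRing.scale /=; ring.
Qed.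

(** Expanding into real and imaginary parts leaves four real integrations by parts, one for each
    pairing of a part of [f] with a part of [F]. *)
Lemma cintegral_ibp (a b : R) (F g f f' : R -> R[i]) : a <= b ->
  absolutely_continuous_on a b F -> cintegrable a b F -> cintegrable a b g ->
  {ae mu, forall t, a <= t <= b -> is_cderive t F (g t)} ->
  (forall t, is_cderive t f (f' t)) -> ccontinuous f' ->
  cintegral a b (fun t => f' t * F t + f t * g t) = f b * F b - f a * F a.
Proof.
move=> ab acF [F1 F2] [g1 g2] dF df [f1 f2].
have dF1 : {ae mu, forall t, a <= t <= b ->
    is_derive t 1 (fun u => complex.Re (F u)) (complex.Re (g t))}.
  move: dF; apply: filterS; first exact: (ae_filter_ringOfSetsType mu).
  by move=> t dFt /dFt[].
have dF2 : {ae mu, forall t, a <= t <= b ->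
    is_derive t 1 (fun u => complex.Im (F u)) (complex.Im (g t))}.
  move: dF; apply: filterS; first exact: (ae_filter_ringOfSetsType mu).
  by move=> t dFt /dFt[].
have df1 (t : R) : is_derive t 1 (fun u => complex.Re (f u)) (complex.Re (f' t)) by case: (df t).
have df2 (t : R) : is_derive t 1 (fun u => complex.Im (f u)) (complex.Im (f' t)) by case: (df t).
have [i11 e11] := acr_ibp ab (acr_Re acF) F1 g1 dF1 df1 f1.
have [i22 e22] := acr_ibp ab (acr_Im acF) F2 g2 dF2 df2 f2.
have [i12 e12] := acr_ibp ab (acr_Im acF) F2 g2 dF2 df1 f1.
have [i21 e21] := acr_ibp ab (acr_Re acF) F1 g1 dF1 df2 f2.
rewrite /cintegral; apply/eqP; rewrite eq_complex; apply/andP; split => /=;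
  apply/eqP.
  transitivity (\int[mu]_(t in `[a, b])
    ((complex.Re (f' t) * complex.Re (F t) + complex.Re (f t) * complex.Re (g t))
    - (complex.Im (f' t) * complex.Im (F t) + complex.Im (f t) * complex.Im (g t)))).
    by apply: eq_Rintegral => t _; rewrite ReD !ReM; ring.
  rewrite RintegralB // e11 e22 -[f b * F b]opprK -opprD raddfN /=.
  by rewrite ReD raddfN /= !ReM; ring.
transitivity (\int[mu]_(t in `[a, b])
  ((complex.Re (f' t) * complex.Im (F t) + complex.Re (f t) * complex.Im (g t))
  + (complex.Im (f' t) * complex.Re (F t) + complex.Im (f t) * complex.Re (g t)))).
  by apply: eq_Rintegral => t _; rewrite ImD !ImM; ring.
rewrite RintegralD // e12 e21 -[f b * F b]opprK -opprD raddfN /=.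
by rewrite ImD raddfN /= !ImM; ring.
Qed.

End IntegrationByParts.

(** * Orthogonal polynomials for an abstract moment form *)

Lemma conj_imag (R : rcfType) : ('i%C : R[i])^* = - 'i%C.
Proof. by apply/eqP; rewrite eq_complex /= oppr0 !eqxx. Qed.

(** Otherwise the difference would vanish at 1, 2, ..., at more points than its degree allows. *)
Lemma poly_eq_nonzero (F : numFieldType) (p q : {poly F}) :
  (forall z, z != 0 -> p.[z] = q.[z]) -> p = q.
Proof.
move=> pq; apply/eqP; rewrite -subr_eq0; apply/eqP/eqP; apply: contraT => d0.
have := @max_poly_roots F (p - q) [seq k.+1%:R | k <- iota 0 (size (p - q))] d0.
rewrite size_map size_iota ltnn; apply.
  by apply/allP => _ /mapP[k _ ->];
    rewrite rootE hornerD hornerN pq ?subrr ?pnatr_eq0.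
rewrite map_inj_uniq ?iota_uniq // => j k /eqP.
by rewrite eqr_nat => /eqP[].
Qed.

Lemma reversedK (R : rcfType) n (p : {poly R[i]}) : (size p <= n.+1)%N ->
  reversed n (reversed n p) = p.
Proof.
move=> sp; apply/polyP => k; rewrite !coef_poly.
case: ltnP => kn; last by rewrite nth_default // (leq_trans sp).
by rewrite ltnS leq_subr subKn // conjCK.
Qed.

(** The coefficient of degree [k] comes from degree [n - k] of [p], and [k = n - (n - k)]. *)
Lemma deriv_reversed (R : rcfType) n (p : {poly R[i]}) :
  'X * (reversed n p)^`() = n%:R *: reversed n p - reversed n ('X * p^`()).
Proof.
have rE q k : (reversed n q)`_k = if (k < n.+1)%N then (q`_(n - k))^* else 0.
  by rewrite coef_poly.
apply/polyP => -[|k]; rewrite coefXM coefB coefZ !rE /=.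
  rewrite subn0 coefXM; case: n {rE} => [|n] /=;
    first by rewrite mul0r rmorph0 subrr.
  by rewrite coef_deriv rmorphMn /= mulr_natl subrr.
rewrite coef_deriv rE; case: ltnP => kn; last by rewrite mul0rn mulr0 subrr.
rewrite coefXM; have [nk|nk] := eqVneq (n - k.+1)%N 0%N.
  have -> : n = k.+1 by lia.
  by rewrite rmorph0 subr0 mulr_natl.
rewrite coef_deriv prednK ?lt0n // rmorphMn /= mulr_natl -mulrnBr; last by lia.
by congr (_ *+ _); lia.
Qed.

Lemma polyAhatE (R : rcfType) (A : {poly R[i]}) : polyAhat A = reversed 3 A.
Proof.
apply/polyP => -[|[|[|[|k]]]];
  rewrite /reversed /polyAhat coef_poly !coefD !coefZ;
  rewrite coefC !coefXn !coefX /= ?(mulr0, mulr1, addr0, add0r) //.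
Qed.

(** Abstracts an inner product on the unit circle: [formX] expresses [|z| = 1], the Toeplitz
    property of the moments, and [form_def] turns orthogonality into vanishing. *)
Record moment_form (R : rcfType) (H : {poly R[i]} -> {poly R[i]} -> R[i]) : Prop :=
  MomentForm {
    formD : forall p q r, H (p + q) r = H p r + H q r;
    formZ : forall c p r, H (c *: p) r = c * H p r;
    formC : forall p q, H q p = (H p q)^*;
    formX : forall p q, H ('X * p) ('X * q) = H p q;
    form_def : forall p, H p p = 0 -> p = 0 }.

(** * Algebra of moment forms *)

Section MomentFormTheory.
Variables (R : rcfType) (H : {poly R[i]} -> {poly R[i]} -> R[i]).
Hypothesis Hform : moment_form H.
Implicit Types p q r : {poly R[i]}.

Lemma form0l q : H 0 q = 0.
Proof. by rewrite -(scale0r (0 : {poly R[i]})) formZ // mul0r. Qed.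

Lemma formB p q r : H (p - q) r = H p r - H q r.
Proof. by rewrite formD // -scaleN1r formZ // mulN1r. Qed.

Lemma form_suml n (F : 'I_n -> {poly R[i]}) q :
  H (\sum_(j < n) F j) q = \sum_(j < n) H (F j) q.
Proof.
apply: (big_morph (fun p => H p q)); last exact: form0l.
by move=> p r; exact: formD.
Qed.

Lemma formDr p q r : H p (q + r) = H p q + H p r.
Proof. by rewrite formC // formD // rmorphD /= -!formC. Qed.

Lemma formZr c p q : H p (c *: q) = c^* * H p q.
Proof. by rewrite formC // formZ // rmorphM /= -formC. Qed.

Lemma form0r p : H p 0 = 0.
Proof. by rewrite formC // form0l rmorph0. Qed.

Lemma form_sumr n (F : 'I_n -> {poly R[i]}) q :
  H q (\sum_(j < n) F j) = \sum_(j < n) H q (F j).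
Proof.
apply: (big_morph (fun p => H q p)); last exact: form0r.
by move=> p r; exact: formDr.
Qed.

Lemma formXn m p q : H ('X^m * p) ('X^m * q) = H p q.
Proof.
elim: m => [|m IH]; first by rewrite expr0 !mul1r.
by rewrite exprS -!mulrA formX.
Qed.

Lemma form_poly n q p : (size q <= n)%N ->
  H p q = \sum_(j < n) (q`_j)^* * H p 'X^j.
Proof.
move=> sq; rewrite -{1}[q](coefK) (@poly_def _ (size q)).
rewrite form_sumr (big_ord_widen n (fun j => H p (q`_j *: 'X^j)) sq).
rewrite [RHS](bigID (fun j : 'I_n => (j < size q)%N)) /=.
rewrite [X in _ = _ + X]big1 ?addr0; first by apply: eq_bigr => j _;
  rewrite formZr.
by move=> j; rewrite -leqNgt => sj; rewrite nth_default // rmorph0 mul0r.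
Qed.

Lemma form_eq0 m q : (size q <= m)%N ->
  (forall k, (k < m)%N -> H q 'X^k = 0) -> q = 0.
Proof.
move=> sq Hq; apply: (form_def Hform); rewrite (form_poly q sq).
by rewrite big1 // => j _; rewrite Hq // mulr0.
Qed.

(** Dividing by [X] shifts the orthogonality relations down by one. This criterion yields both
    Szegő's recurrence and the structure relation. *)
Lemma form_eq0_shift m q : (size q <= m.+1)%N -> q`_0 = 0 ->
  (forall k, (0 < k <= m)%N -> H q 'X^k = 0) -> q = 0.
Proof.
move=> sq q0 Hq.
have qE : q = 'X * \poly_(i < m) q`_i.+1.
  apply/polyP => -[|i]; rewrite coefXM //= coef_poly.
  by case: ltnP => // mi; rewrite nth_default // (leq_trans sq).
rewrite qE (@form_eq0 m (\poly_(i < m) q`_i.+1)) ?mulr0 ?size_poly // => k km.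
by rewrite -formX // -qE -exprS Hq.
Qed.

(* Reversal is [p |-> X^n conj p] on the circle. *)
Lemma form_reversed n a b p : (size p <= n.+1)%N ->
  H ('X^a * reversed n p) 'X^b = H 'X^(n + a) ('X^b * p).
Proof.
move=> sp; rewrite /reversed poly_def mulr_sumr form_suml.
have pE : 'X^b * p = \sum_(j < n.+1) p`_j *: 'X^(b + j).
  rewrite -{1}[p]coefK (@poly_def _ (size p)) mulr_sumr.
  rewrite (big_ord_widen n.+1 (fun j => 'X^b * (p`_j *: 'X^j)) sp).
  rewrite [RHS](bigID (fun j : 'I_n.+1 => (j < size p)%N)) /=.
  rewrite [X in _ = _ + X]big1 ?addr0.
    by apply: eq_bigr => j _; rewrite -scalerAr exprD.
  by move=> j; rewrite -leqNgt => sj; rewrite nth_default // scale0r.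
rewrite pE form_sumr [RHS](reindex_inj rev_ord_inj) /=.
apply: eq_bigr => -[k /= kn] _; rewrite -scalerAr formZ // formZr subSS -exprD.
(* The two pairings of index [k] differ by a common factor [X^(n - k)], which [formXn] removes. *)
have -> : (n + a = (n - k) + (a + k))%N by lia.
have -> : (b + (n - k) = (n - k) + b)%N by lia.
by rewrite !(exprD _ (n - k)) formXn.
Qed.

(** * Orthogonality and Szegő's recurrence *)

Section OrthogonalPolynomials.
Variable Phi : nat -> {poly R[i]}.
Hypothesis size_Phi : forall n, size (Phi n) = n.+1.
Hypothesis monic_Phi : forall n, Phi n \is monic.
Hypothesis orth_Phi : forall n m, n <> m -> H (Phi n) (Phi m) = 0.

Local Notation alpha := (verblunsky Phi).
Local Notation Phis n := (reversed n (Phi n)).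
Local Notation kap n := (H (Phi n) (Phi n)).

Lemma coef_Phi_lead n : (Phi n)`_n = 1.
Proof. by have /monicP := monic_Phi n; rewrite lead_coefE size_Phi. Qed.

Lemma size_reduce d q : (size q <= d.+1)%N -> (size (q - q`_d *: Phi d)%R <= d)%N.
Proof.
move=> sq; apply/leq_sizeP => j; rewrite leq_eqVlt => /predU1P[<-|dj].
  by rewrite coefB coefZ coef_Phi_lead mulr1 subrr.
rewrite coefB coefZ [q`_j]nth_default ?(leq_trans sq) //.
by rewrite [(Phi d)`_j]nth_default ?size_Phi // mulr0 subr0.
Qed.

(** Induction on the size: a multiple of [Phi d], itself orthogonal to [Phi n], removes the term of
    degree [d]. *)
Lemma orth_low n q : (size q <= n)%N -> H (Phi n) q = 0.
Proof.
suff orth d : (d <= n)%N -> forall r, (size r <= d)%N -> H (Phi n) r = 0.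
  exact: orth.
elim: d => [|d IH] dn r; first by rewrite size_poly_leq0 => /eqP ->;
  rewrite form0r.
move=> /size_reduce sr; rewrite -(subrK (r`_d *: Phi d) r) formDr formZr.
by rewrite (IH (ltnW dn)) // orth_Phi ?mulr0 ?addr0 //; lia.
Qed.

Lemma kap_conj n : (kap n)^* = kap n.
Proof. by rewrite -formC. Qed.

Lemma form_Phi_Xn n : H (Phi n) 'X^n = kap n.
Proof.
have := @size_reduce n 'X^n; rewrite size_polyXn coefXn eqxx scale1r leqnn.
move=> /(_ isT) /orth_low; rewrite -[X in _ - X]scale1r -scaleNr formDr formZr.
by rewrite rmorphN rmorph1 mulN1r => /eqP; rewrite subr_eq0 => /eqP.
Qed.

(** [X^(n+1)] is [Phi n.+1 - l Phi n] up to degree below [n]; [l] is conjugated because it sits in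
    the second argument. *)
Lemma form_Phi_XSn n : H (Phi n) 'X^(n.+1) = - ((Phi n.+1)`_n)^* * kap n.
Proof.
set l := (Phi n.+1)`_n; set q := 'X^(n.+1) - Phi n.+1.
have sq : (size q <= n.+1)%N.
  by have := @size_reduce n.+1 'X^(n.+1);
    rewrite size_polyXn coefXn eqxx scale1r; exact.
have qn : q`_n = - l by rewrite coefB coefXn (ltn_eqF (ltnSn n)) sub0r.
have := orth_low (size_reduce sq); rewrite qn scaleNr opprK formDr formZr.
rewrite /q -[X in _ - X]scale1r -scaleNr formDr formZr orth_Phi ?mulr0 ?addr0;
  last by lia.
by move=> /eqP; rewrite addr_eq0 mulNr => /eqP.
Qed.

Lemma form_Phi_gap n j k : (j <= k < j + n)%N -> H ('X^j * Phi n) 'X^k = 0.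
Proof.
move=> /andP[jk kn]; rewrite -(subnKC jk) exprD formXn orth_low // size_polyXn.
by lia.
Qed.

Lemma form_Phis n a b : H ('X^a * Phis n) 'X^b = H 'X^(n + a) ('X^b * Phi n).
Proof. by rewrite form_reversed // size_Phi. Qed.

(** Reversal moves the orthogonality of [Phi n] from [1, ..., X^(n-1)] to [X, ..., X^n]; the factor
    [X^j] shifts the range. *)
Lemma form_Phis_gap n j k : (j < k <= j + n)%N -> H ('X^j * Phis n) 'X^k = 0.
Proof.
by move=> jk; rewrite form_Phis formC // form_Phi_gap ?rmorph0 //; lia.
Qed.

Lemma form_Phis_diag n j : H ('X^j * Phis n) 'X^j = kap n.
Proof.
by rewrite form_Phis addnC exprD formXn formC // form_Phi_Xn kap_conj.
Qed.

Lemma coef0_Phi n : (Phi n.+1)`_0 = - (alpha n)^*.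
Proof. by rewrite /verblunsky rmorphN /= conjCK opprK horner_coef0. Qed.

Lemma coef_Phis n k : (k <= n)%N -> (Phis n)`_k = ((Phi n)`_(n - k))^*.
Proof. by move=> kn; rewrite coef_poly ltnS kn. Qed.

Lemma size_Phis n : (size (Phis n) <= n.+1)%N.
Proof. exact: size_poly. Qed.

(** The leading terms cancel, the constant terms agree by definition of [alpha n], and all three
    polynomials are orthogonal to [X, ..., X^n], so the difference is zero. *)
Lemma szego n : Phi n.+1 = 'X * Phi n - (alpha n)^* *: Phis n.
Proof.
apply/eqP; rewrite -subr_eq0; apply/eqP; apply: (@form_eq0_shift n).
- apply/leq_sizeP => j; rewrite leq_eqVlt => /predU1P[<-|nj].
    rewrite !coefB coefXM coefZ /= !coef_Phi_lead.
    by rewrite (nth_default _ (size_Phis n)) mulr0 subr0 subrr.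
  rewrite !coefB coefXM coefZ /=; case: j nj => // j nj /=.
  rewrite [(Phi n.+1)`_j.+1]nth_default ?size_Phi //.
  rewrite [(Phi n)`_j]nth_default ?size_Phi //.
  by rewrite [(Phis n)`_j.+1]nth_default ?mulr0 ?subrr // (leq_trans (size_Phis n)) // ltnW.
- rewrite !coefB coefXM coefZ /= coef_Phis // subn0 coef_Phi_lead rmorph1 mulr1 coef0_Phi.
  by rewrite sub0r subrr.
- case=> // k kn; rewrite !formB formZ // exprS formX // -exprS.
  rewrite orth_low ?size_polyXn // orth_low ?size_polyXn // sub0r.
  by rewrite -(mul1r (Phis n)) -(expr0 'X) form_Phis_gap // mulr0 subrr oppr0.
Qed.

Lemma coef_Phi_sub n :
  (Phi n.+2)`_n.+1 = (Phi n.+1)`_n + (alpha n.+1)^* * alpha n.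
Proof.
rewrite szego coefB coefXM coefZ /= coef_Phis // subnn.
by rewrite -horner_coef0 -[X in _ * X]opprK -/(alpha n) mulrN opprK.
Qed.

(** Szegő's recurrence paired with 1, to which [Phi n.+1] is orthogonal. *)
Lemma form_XPhi_1 n : H ('X * Phi n) 1 = (alpha n)^* * kap n.
Proof.
have : H (Phi n.+1) 1 = 0 by rewrite orth_low // size_poly1.
rewrite szego formB formZ // => /eqP; rewrite subr_eq0 => /eqP ->.
by have := form_Phis_diag n 0; rewrite expr0 mul1r => ->.
Qed.

(** Szegő's recurrence paired with [X^(n+1)]: the reversed polynomial contributes the term in
    [alpha n]. *)
Lemma kap_succ n : kap n.+1 = (1 - `|alpha n| ^+ 2) * kap n.
Proof.
rewrite -(form_Phi_Xn n.+1) {1}szego formB formZ // exprS formX // form_Phi_Xn.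
have -> : H (Phis n) ('X * 'X^n) = alpha n * kap n.
  have := form_Phis n 0 n.+1; rewrite expr0 mul1r addn0 -exprS => ->.
  rewrite -[X in H X]mulr1 exprSr -mulrA formXn formC // form_XPhi_1 rmorphM /=.
  by rewrite conjCK kap_conj.
by rewrite normCK; ring.
Qed.

(** By Szegő's recurrence [X^2 Phi n] is [X Phi n.+1] plus a multiple of [X] times the reversed
    polynomial, and both pairings are known. *)
Lemma form_X2Phi_1 n : H ('X^2 * Phi n) 1 =
  ((alpha n.+1)^* * (1 - `|alpha n| ^+ 2) - (alpha n)^* * (Phi n.+1)`_n) * kap n.
Proof.
have -> : 'X^2 * Phi n = 'X * Phi n.+1 + (alpha n)^* *: ('X * Phis n).
  by rewrite szego mulrBr -scalerAr subrK mulrA expr2.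
rewrite formD // formZ // form_XPhi_1 kap_succ.
have -> : H ('X * Phis n) 1 = - (Phi n.+1)`_n * kap n.
  have := form_Phis n 1 0; rewrite expr0 mul1r expr1 => ->.
  by rewrite addn1 formC // form_Phi_XSn rmorphM rmorphN /= conjCK kap_conj.
by ring.
Qed.

(** * The structure relation for the derivative *)

Variables A B : {poly R[i]}.
Hypotheses (sizeA : (size A <= 4)%N) (sizeB : (size B <= 4)%N).
Hypothesis pearsonH : forall p k,
  H ('X * A * p^`()) 'X^k = H (('i%C *: B + k%:R *: A) * p) 'X^k.

Local Notation U n := (polyU A B Phi n).
Local Notation V n := (polyV A B Phi n).
Local Notation W n := (polyW A B Phi n).
Local Notation Y n := (polyY A B Phi n).

Lemma poly4E p : (size p <= 4)%N ->
  p = p`_0 *: 'X^0 + p`_1 *: 'X^1 + p`_2 *: 'X^2 + p`_3 *: 'X^3.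
Proof.
move=> sp; apply/polyP => -[|[|[|[|j]]]];
  rewrite !coefD !coefZ !coefXn /= ?mulr0 ?mulr1 ?addr0 ?add0r //.
by rewrite nth_default // (leq_trans sp).
Qed.

Lemma form_mul4 p q r : (size p <= 4)%N -> H (p * q) r =
  p`_0 * H ('X^0 * q) r + p`_1 * H ('X^1 * q) r + p`_2 * H ('X^2 * q) r
  + p`_3 * H ('X^3 * q) r.
Proof.
by move=> sp; rewrite {1}(poly4E sp) !mulrDl -!scalerAl !formD // !formZ.
Qed.

Lemma size_polyU n : (size (U n) <= 4)%N.
Proof.
rewrite /polyU; apply/leq_sizeP => -[|[|[|[|j]]]] // _.
by rewrite !coefD !coefZ coefC !coefXn coefX /= !mulr0 !addr0.
Qed.

Lemma size_polyV n : (size (V n) <= 3)%N.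
Proof.
rewrite /polyV; apply/leq_sizeP => -[|[|[|j]]] // _.
by rewrite !coefD coefN !coefZ coefC !coefXn coefX /= !mulr0 !addr0 subr0.
Qed.

Lemma coef_mul4 p q k : (size p <= 4)%N ->
  (p * q)`_k.+3 = p`_0 * q`_k.+3 + p`_1 * q`_k.+2 + p`_2 * q`_k.+1 + p`_3 * q`_k.
Proof.
move=> sp; rewrite {1}(poly4E sp) expr0 expr1 !mulrDl -!scalerAl mul1r.
by rewrite !coefD !coefZ !coefXnM coefXM /= !subSS !subn0.
Qed.

Lemma coef_polyU n : [/\ (U n)`_0 = 'i%C * B`_0 + n%:R * A`_0,
  (U n)`_1 = coef_s A B Phi n,
  (U n)`_2 = coef_s1 A B Phi n + n%:R * A`_3 * (alpha n.+1)^* * alpha n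
  & (U n)`_3 = n%:R * A`_3].
Proof.
by split; rewrite /polyU !coefD !coefZ coefC !coefXn coefX /=
  ?(mulr0, mulr1, addr0, add0r).
Qed.

(** The zero cubic coefficient is listed so that [polyV] can be handled at formal degree three, like
    [polyU]. *)
Lemma coef_polyV n : [/\ (V n)`_0 = ('i%C * B`_0 + n%:R * A`_0) * (alpha n.-1)^*,
  (V n)`_1 = - (coef_s1 A B Phi n * (alpha n)^* + n%:R * A`_3 * (alpha n.+1)^*
                - coef_t A B Phi n),
  (V n)`_2 = ('i%C * B`_3 - (n%:R - 2) * A`_3) * (alpha n)^*
  & (V n)`_3 = 0].
Proof.
by split; rewrite /polyV !coefD coefN !coefZ coefC !coefXn coefX /=
  ?(mulr0, mulr1, oppr0, addr0, add0r).
Qed.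

Definition structure_defect n :=
  'X * A * (Phi n)^`() - U n * Phi n - V n * Phis n.

Lemma coef0_structure_defect n : (0 < n)%N -> (structure_defect n)`_0 = 0.
Proof.
case: n => // n _; rewrite /structure_defect !coefB -mulrA coefXM !coef0M coef_Phis // subn0.
rewrite coef_Phi_lead rmorph1 mulr1 sub0r coef0_Phi.
have [-> _ _ _] := coef_polyU n.+1; have [-> _ _ _] := coef_polyV n.+1.
by rewrite mulrN opprK subrr.
Qed.

(** The Pearson identity trades the derivative for the multiplier ['i B + k A], after which most
    pairings with [X^k] fall in an orthogonality gap. The others cancel: [k = 1] and [k = 2] fix the
    coefficients of [V n] in degrees 1 and 2, [k = n] and [k = n + 1] those of [U n] in degrees 0
    and 1. *)
Lemma form_structure_defect n k : (3 <= n)%N -> (0 < k <= n.+1)%N ->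
  H (structure_defect n) 'X^k = 0.
Proof.
move=> n3 kn.
have sV := leq_trans (size_polyV n) (leqnSn 3); have sU := size_polyU n.
rewrite /structure_defect !formB // pearsonH.
rewrite (@form_mul4 (U n)) // (@form_mul4 (V n)) // (@form_mul4 ('i%C *: B + _)); last first.
  by rewrite (leq_trans (size_polyD _ _)) // geq_max !(leq_trans (size_scale_leq _ _)).
have [-> -> -> ->] := coef_polyU n; have [-> -> -> ->] := coef_polyV n.
rewrite !coefD !coefZ mul0r addr0.
set P := Phi n; pose S := Phis n; rewrite -/S.
have gP j : (j <= k < j + n)%N -> H ('X^j * P) 'X^k = 0 by exact: form_Phi_gap.
have gS j : (j < k <= j + n)%N -> H ('X^j * S) 'X^k = 0 by exact: form_Phis_gap.
have XP m : H ('X^(m.+1) * P) 'X^m = (alpha n)^* * kap n.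
  by rewrite -form_XPhi_1 -(formXn m ('X * P) 1) exprSr mulrA mulr1.
have eqn : n = n.-1.+1 by lia.
(* [coef_s] involves the subleading coefficient of [Phi n], the pairing with [X^(n+1)] that of
   [Phi n.+1]. *)
have lS : (Phi n.+1)`_n = (Phi n)`_n.-1 + (alpha n)^* * alpha n.-1.
  by rewrite {1 2}eqn coef_Phi_sub -eqn.
(* Since [3 <= n], the cases near 1 and near [n] do not overlap. *)
have [k1|[k2|[k3|[kn1|kn2]]]] :
  k = 1 \/ k = 2 \/ (3 <= k < n)%N \/ k = n \/ k = n.+1 by lia.
- rewrite (gP 0) ?(gP 1) ?(gS 0); [|lia..].
  rewrite k1 XP (form_Phis_diag n 1).
  have -> : H ('X^3 * P) 'X^1 = ((alpha n.+1)^* * (1 - `|alpha n| ^+ 2) -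
      (alpha n)^* * (Phi n.+1)`_n) * kap n.
    by rewrite -form_X2Phi_1 -(formXn 1 ('X^2 * P) 1) mulrA mulr1.
  have -> : H ('X^2 * S) 'X^1 = - (Phi n.+1)`_n * kap n.
    rewrite form_Phis addn2 exprS expr1 formX // formC // form_Phi_XSn.
    by rewrite rmorphM rmorphN /= conjCK kap_conj.
  rewrite /coef_t normCK; ring.
- rewrite (gP 0) ?(gP 1) ?(gP 2) ?(gS 0) ?(gS 1); [|lia..].
  by rewrite k2 XP (form_Phis_diag n 2); ring.
- rewrite (gP 0) ?(gP 1) ?(gP 2) ?(gP 3) ?(gS 0) ?(gS 1) ?(gS 2); [|lia..].
  by ring.
- rewrite (gP 1) ?(gP 2) ?(gP 3) ?(gS 0) ?(gS 1) ?(gS 2); [|lia..].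
  by rewrite kn1; ring.
- rewrite (gP 2) ?(gP 3) ?(gS 1) ?(gS 2); [|lia..].
  have -> : H ('X^0 * P) 'X^k = - ((Phi n.+1)`_n)^* * kap n.
    by rewrite expr0 mul1r kn2 form_Phi_XSn.
  have -> : H ('X^1 * P) 'X^k = kap n.
    by rewrite kn2 (exprS _ n) expr1 formX // form_Phi_Xn.
  have -> : H ('X^0 * S) 'X^k = alpha n * kap n.
    rewrite form_Phis addn0 kn2 -{1}['X^n]mulr1 exprSr -mulrA formXn formC // form_XPhi_1.
    by rewrite rmorphM /= conjCK kap_conj.
  by rewrite kn2 lS /coef_s rmorphD rmorphM /= conjCK -natr1; ring.
Qed.

(** The degree is a priori at most [n + 3]; the two top coefficients vanish by the choice of the
    coefficients of [U n] in degrees 3 and 2. *)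
Lemma size_structure_defect n : (3 <= n)%N -> (size (structure_defect n) <= n.+2)%N.
Proof.
move=> n3; apply/leq_sizeP => j nj.
have [i ij] : exists i, j = i.+4 by exists (j - 4)%N; lia.
have sV := leq_trans (size_polyV n) (leqnSn 3); have sU := size_polyU n.
rewrite /structure_defect !coefB -mulrA coefXM ij /= !coef_mul4 // !coef_deriv.
have [-> -> -> ->] := coef_polyU n; have [-> -> -> ->] := coef_polyV n.
set P := Phi n; pose S := Phis n; rewrite -/S.
have P0 k : (n < k)%N -> P`_k = 0 by move=> nk; rewrite nth_default // size_Phi.
have S0 k : (n < k)%N -> S`_k = 0.
  by move=> nk; rewrite nth_default // (leq_trans (size_Phis n)).
have Sn : S`_n = - alpha n.-1.
  by rewrite coef_Phis // subnn -horner_coef0 /verblunsky opprK prednK //; lia.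
rewrite (P0 i.+4) ?(P0 i.+3) ?(S0 i.+4) ?(S0 i.+3); [|lia..].
(* With [j = i + 4], these are the coefficients of [X^(n+2)], of [X^(n+3)] and of higher powers. *)
have [i2|[i1|i0]] : n = i.+2 \/ n = i.+1 \/ (n < i.+1)%N by lia.
- have P1 : P`_i.+2 = 1 by rewrite /P i2 coef_Phi_lead.
  rewrite P1; rewrite i2 in Sn; rewrite Sn.
  rewrite /coef_s1 /P i2 /= !coef_Phi_sub -(mulr_natr _ i.+1) -!natr1.
  by ring.
- have P1 : P`_i.+1 = 1 by rewrite /P i1 coef_Phi_lead.
  rewrite (P0 i.+2) ?(S0 i.+2) ?P1; [|lia..].
  by rewrite i1; ring.
- rewrite (P0 i.+2) ?(P0 i.+1) ?(S0 i.+2); [|lia..].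
  by ring.
Qed.

Lemma structure_relation n : (3 <= n)%N ->
  'X * A * (Phi n)^`() = U n * Phi n + V n * Phis n.
Proof.
move=> n3; have /eqP : structure_defect n = 0.
  apply: (@form_eq0_shift n.+1); first exact: size_structure_defect.
    by apply: coef0_structure_defect; lia.
  by move=> k; exact: form_structure_defect.
by rewrite /structure_defect subr_eq0 subr_eq => /eqP ->; rewrite addrC.
Qed.

(** * Reversal of the structure relation and the differential equation *)

Lemma reversed_polyU n : reversed 3 (U n) = 'X * Y n + n%:R *: polyAhat A.
Proof.
have [U0 U1 U2 U3] := coef_polyU n.
apply/polyP => -[|[|[|[|k]]]]; last first.
- rewrite /reversed coef_poly /= coefD coefXM coefZ /polyAhat /polyY !coefD !coefZ.
  by rewrite !coefC !coefXn !coefX /= !(mulr0, addr0).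
all: rewrite /reversed coef_poly /= ?(U0, U1, U2, U3) coefD coefXM coefZ.
all: rewrite /polyAhat /polyY !coefD !coefZ !coefC !coefXn !coefX /=.
all: move: (alpha n) (alpha n.+1) (coef_s A B Phi n) (coef_s1 A B Phi n) => al al' s s1.
all: rewrite ?(rmorphD, rmorphM, rmorph_nat) /= ?conjCK ?conj_imag.
all: by ring.
Qed.

(** With [reversed_polyU], this shows the origin of [W n] and [Y n]: they are the reversals at
    formal degree three of [V n] and [U n - n A], divided by [X]. *)
Lemma reversed_polyV n : reversed 3 (V n) = 'X * W n.
Proof.
have [V0 V1 V2 V3] := coef_polyV n.
apply/polyP => -[|[|[|[|k]]]]; last first.
- rewrite /reversed coef_poly /= coefXM /polyW !coefD !coefN !coefZ.
  by rewrite !coefC !coefXn !coefX /= !(mulr0, addr0, oppr0).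
all: rewrite /reversed coef_poly /= ?(V0, V1, V2, V3) coefXM.
all: rewrite /polyW ?coefD ?coefN ?coefZ ?coefC ?coefXn ?coefX /= /coef_p.
all: move: (alpha n) (alpha n.-1) (alpha n.+1) (coef_s1 A B Phi n) (coef_t A B Phi n).
all: move=> al al' al'' s1 t.
all: rewrite !(rmorph0, rmorphN, rmorphB, rmorphD, rmorphM, rmorph_nat) /= ?conjCK ?conj_imag.
all: by ring.
Qed.

(** The structure relation is evaluated at [1 / z^*] and conjugated, which turns each factor into
    its reversal over a power of [z]. *)
Lemma reversed_relation n : (3 <= n)%N ->
  polyAhat A * (Phis n)^`() = - (Y n * Phis n + W n * Phi n).
Proof.
move=> n3; apply: poly_eq_nonzero => z z0; apply: (mulfI z0).
set y : R[i] := 1 / z^*.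
have ev m p : (size p <= m.+1)%N -> (p.[y])^* = (reversed m p).[z] / z ^+ m.
    move=> sp; rewrite reversedE // mulrAC.
 by rewrite divff ?expf_neq0 // [1 * _^*]mul1r.
have sX : (size ('X * (Phi n)^`())%R <= n.+1)%N.
  apply/leq_sizeP => -[|j] nj; rewrite coefXM //=.
  by rewrite coef_deriv nth_default ?mul0rn ?size_Phi.
have := congr1 (fun p : {poly R[i]} => (p.[y])^*) (structure_relation n3).
(* [X] is grouped with the derivative: the product has degree at most [n], and its reversal occurs
   in [deriv_reversed]. *)
rewrite [_ * A]mulrC -mulrA hornerD !hornerM -[X in A.[y] * X]hornerM.
rewrite rmorphD !rmorphM /=.
rewrite (ev 3%N A) // (ev n _ sX) (ev 3%N (U n)) ?size_polyU //.
rewrite (ev n (Phi n)) ?size_Phi // (ev 3%N (V n)) ?(leq_trans (size_polyV n)) //.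
rewrite (ev n (Phis n)) ?size_Phis // reversedK ?size_Phi //.
rewrite reversed_polyU reversed_polyV -polyAhatE //.
move: (polyAhat A) (Y n) (W n) => Ah Yn Wn.
have := congr1 (fun p : {poly R[i]} => p.[z]) (@deriv_reversed R n (Phi n)).
rewrite hornerM hornerX [in RHS]hornerD hornerN hornerZ.
rewrite hornerN !hornerD !hornerM !hornerX hornerZ.
move: (reversed n ('X * _)).[z] (Phis n)^`().[z] (Phis n).[z] (Phi n).[z] => r d s P zd.
move: Ah.[z] Yn.[z] Wn.[z] => a y' w E.
have c0 : (z ^+ 3 * z ^+ n)^-1 != 0 by rewrite invr_eq0 mulf_neq0 // expf_neq0.
have {E} : a * r = (z * y' + n%:R * a) * s + z * w * P.
  apply: (mulIf c0); rewrite invfM.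
  rewrite [LHS](_ : _ = a / z ^+ 3 * (r / z ^+ n)); last by ring.
  by rewrite E; ring.
(* The multiple [n] of [polyAhat] cancels between the reversed [U n] and the derivative formula. *)
rewrite mulrCA zd mulrBr => ->; ring.
Qed.

Lemma reversed_ode n (z : R[i]) : (3 <= n)%N -> z * A.[z] != 0 ->
  let Theta := step (W n) in
  (polyAhat A).[z] * ((Phis n)^`()^`()).[z]
  + ((polyAhat A)^`().[z] + (Y n).[z]
     - Theta * (polyAhat A).[z] * (U n).[z] * (z * A.[z])^-1) * (Phis n)^`().[z]
  + (Theta * ((V n).[z] * (W n).[z] - (U n).[z] * (Y n).[z]) * (z * A.[z])^-1
     + (Y n)^`().[z]) * (Phis n).[z]
  = - ((W n)^`().[z] * (Phi n).[z]).
Proof.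
move=> n3 zA /=; have := congr1 (fun p : {poly R[i]} => p.[z]) (structure_relation n3).
have E2 := reversed_relation n3.
have := congr1 (fun p : {poly R[i]} => p^`().[z]) E2.
move/(congr1 (fun p : {poly R[i]} => p.[z])) : E2.
move: (polyAhat A) (U n) (V n) (W n) (Y n) (Phis n) => Ah Un Vn Wn Yn S.
move: (Phi n) => P.
rewrite !(derivM, derivD, derivN) !(hornerM, hornerD, hornerN) hornerX.
move: zA; set b := z * A.[z] => zA.
rewrite /step; case: eqVneq => [->|_].
  (* When [W n] is zero, the derivative of the reversed relation is already the equation. *)
  rewrite deriv0 !horner0 => _ E3 _.
  rewrite [LHS](_ : _ = (Ah^`().[z] * S^`().[z] + Ah.[z] * S^`()^`().[z])
    + (Yn.[z] * S^`().[z] + Yn^`().[z] * S.[z])); last by ring.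
  by rewrite E3; ring.
move=> E2 E3 E1; have {}E1 : P^`().[z] = (Un.[z] * P.[z] + Vn.[z] * S.[z]) / b.
  by rewrite -E1 mulrAC mulfV // mul1r.
rewrite E1 in E3.
(* Grouped for [E3] and [E2]: the [Un / b] term, rewritten by [E2], cancels the part of [Wn P'] in
   [P], and the [Vn Wn] term cancels the part in [S]. *)
rewrite [LHS](_ : _ = (Ah^`().[z] * S^`().[z] + Ah.[z] * S^`()^`().[z])
  + (Yn.[z] * S^`().[z] + Yn^`().[z] * S.[z]) - Un.[z] / b * (Ah.[z] * S^`().[z])
  + (Vn.[z] * Wn.[z] - Un.[z] * Yn.[z]) / b * S.[z]); last by ring.
by rewrite E3 E2; ring.
Qed.

End OrthogonalPolynomials.
End MomentFormTheory.

(** * The form attached to a weight *)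

Section WeightForm.
Variables (R : realType) (w : R -> R).
Hypothesis w_weight : weight_function w.
Local Open Scope classical_set_scope.
Local Notation mu := (@lebesgue_measure R).
Local Notation H p q := (inner w (horner p) (horner q)).
Implicit Types p q : {poly R[i]}.

Let twopi_ge0 : 0 <= 2 * pi :> R.
Proof. by rewrite mulr_ge0 // pi_ge0. Qed.

Lemma expi_mul_conj (t : R) : expi t * (expi t)^* = 1.
Proof.
apply/eqP; rewrite eq_complex ReM ImM /= mulrN opprK -!expr2 cos2Dsin2 eqxx /=.
by rewrite mulrN mulrC addNr.
Qed.

Lemma expi_0 : expi 0 = 1 :> R[i].
Proof. by rewrite /expi cos0 sin0. Qed.

Lemma expi_2pi : expi (2 * pi) = 1 :> R[i].
Proof. by rewrite /expi mulr_natl cos2pi sin2pi. Qed.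

Lemma ccontinuous_trig p q : ccontinuous (fun t : R => p.[expi t] * (q.[expi t])^*).
Proof.
apply: is_cderive_ccontinuous => t; apply: is_cderiveM;
  first exact: is_cderive_horner.
by apply: is_cderive_conj; exact: is_cderive_horner.
Qed.

Lemma ccontinuous_horner p : ccontinuous (fun t : R => p.[expi t]).
Proof. by apply: is_cderive_ccontinuous => t; exact: is_cderive_horner. Qed.

Lemma cintegrable_weight : cintegrable 0 (2 * pi) (fun t => (w t)%:C%C).
Proof. by have [iw _ _] := w_weight; split => //=; exact: integrable0. Qed.

Lemma cintegrable_inner p q :
  cintegrable 0 (2 * pi) (fun t => p.[expi t] * (q.[expi t])^* * (w t)%:C%C).
Proof. by apply: cintegrableM cintegrable_weight => //;
  exact: ccontinuous_trig. Qed.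

(** [H p p] integrates [|p|^2 w], so this product vanishes almost everywhere. A nonzero [p] has
    finitely many zeros on the circle, so [w] would vanish almost everywhere, against its positive
    mass. *)
Lemma inner_definite p : H p p = 0 -> p = 0.
Proof.
move=> Hp0; apply/eqP; apply: contraT => p0; have [iw w0 wpos] := w_weight.
pose n (t : R) := complex.Re (p.[expi t] * (p.[expi t])^* * (w t)%:C%C).
have nE t : n t = (complex.Re p.[expi t] ^+ 2 + complex.Im p.[expi t] ^+ 2) * w t.
  by rewrite /n !ReM ImM ReJ ImJ /=; ring.
have n0 t : 0 <= t <= 2 * pi -> 0 <= n t.
  by move=> t2; rewrite nE mulr_ge0 ?w0 // addr_ge0 // sqr_ge0.
have [intn _] := cintegrable_inner p p; rewrite -/n in intn.
have intn0 : (\int[mu]_(t in `[0%R, (2 * pi)%R]) `|(n t)%:E|)%E = 0%E.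
  have := f_equal (@complex.Re R) Hp0; rewrite /inner /cintegral /= -/n => In0.
  transitivity (\int[mu]_(t in `[0%R, (2 * pi)%R]) (n t)%:E)%E; last first.
    by rewrite -(fineK (integrable_fin_num _ intn)) // -/(Rintegral _ _ _) In0.
  apply: eq_integral => t; rewrite inE /= in_itv /= => t2.
  by rewrite ger0_norm // n0.
have n_ae : ae_eq mu `[0, 2 * pi] (EFin \o n) (cst 0%E).
  apply/ae_eq_integral_abs => //; exact: (measurable_int mu).
pose Z := [set t : R | 0 <= t <= 2 * pi /\ p.[expi t] = 0].
have cZ : countable Z.
  apply: finite_set_countable.
  have [r pE] := closed_field_poly_normal p.
  have root_r z : p.[z] = 0 -> z \in r.
    rewrite {1}pE hornerZ => /eqP; rewrite mulf_eq0 lead_coef_eq0 (negPf p0) /=.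
    by rewrite -rootE root_prod_XsubC.
  pose s := map (@complex.Re R) r.
  have Zcos t : p.[expi t] = 0 -> cos t \in s.
    by move=> /root_r tr; rewrite -[cos t]/(complex.Re (expi t)) map_f.
  (* A zero is recorded by its cosine, the real part of a root of [p]. Cosine is injective on each
     half of the period, the second half being a shift of the first by [pi]. *)
  have fin (S : set R) : {in S &, injective (@cos R)} ->
      (forall t, S t -> p.[expi t] = 0) -> finite_set S.
    move=> injS SZ; rewrite -(eq_finite_set (inj_card_eq injS)).
    apply: (sub_finite_set _ (finite_seq s)) => _ [t St <-].
    exact/Zcos/SZ.
  apply: (@sub_finite_set _ _
    ([set t | 0 <= t <= pi /\ p.[expi t] = 0] `|` [set t | pi <= t <= 2 * pi /\ p.[expi t] = 0])).
    move=> t [/andP[t0 t2] pt]; have [tp|pt'] := leP t pi; first by left;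
      rewrite /= t0.
    by right; rewrite /= t2 ltW.
  rewrite finite_setU; split; apply: fin => [s1 s2|t [] //].
    rewrite !inE /= => -[s1p _] [s2p _] /cos_inj; apply; rewrite in_itv //.
  rewrite !inE /= => -[/andP[a1 b1] _] [/andP[a2 b2] _] ss.
  have : s1 - pi = s2 - pi.
    apply: cos_inj; rewrite ?in_itv /= ?subr_ge0 ?a1 ?a2 /=; [lra|lra|].
    by apply: oppr_inj; rewrite -!cosDpi !subrK.
  exact: addIr.
have nZ : {ae mu, forall t, ~ Z t}.
  exists Z; split; last by move=> t /= /contrapT.
    exact: countable_measurable.
  exact: countable_lebesgue_measure0.
have w_ae : ae_eq mu `[0, 2 * pi] (EFin \o w) (cst 0%E).
  have [M [mM M0 bad]] := negligibleU n_ae nZ; exists M; split => // t wt.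
  apply: bad; rewrite -setCI; apply: contra_not wt => -[nt nZt] t2 /=;
    have := nt t2; rewrite /= nE => -[/eqP].
  rewrite mulf_eq0 => /orP[|/eqP -> //].
  rewrite paddr_eq0 ?sqr_ge0 // !sqrf_eq0 => /andP[re0 im0]; case: nZt.
  split; first by move: t2; rewrite /= in_itv.
  by apply/eqP; rewrite eq_complex re0.
have w00 : (\int[mu]_(t in `[0%R, (2 * pi)%R]) (w t)%:E)%E = 0%E.
  transitivity (\int[mu]_(t in `[0%R, (2 * pi)%R]) (cst 0 t)%E)%E;
    last exact: integral0.
  by apply: ae_eq_integral => //; exact: (measurable_int mu).
by rewrite w00 ltxx in wpos.
Qed.

Lemma inner_moment_form : moment_form (fun p q => H p q).
Proof.
split => [p q r|c p r|p q|p q|p]; last exact: inner_definite.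
- rewrite /inner -cintegralD; [|exact: cintegrable_inner..].
  by congr cintegral; apply/funext => t; rewrite hornerD !mulrDl.
- rewrite /inner -cintegralZ; last exact: cintegrable_inner.
  by congr cintegral; apply/funext => t; rewrite hornerZ !mulrA.
- rewrite /inner -cintegral_conj; last exact: cintegrable_inner.
  congr cintegral; apply/funext => t; rewrite !rmorphM /= conjCK [_^* * _]mulrC.
  by congr (_ * _); apply/eqP; rewrite eq_complex /= oppr0 !eqxx.
- congr cintegral; apply/funext => t;
  rewrite !hornerM hornerX rmorphM /= mulrACA.
  by rewrite expi_mul_conj mul1r.
Qed.

(** Integration by parts of [A w] against [p] times the conjugate of [X^k]. The boundary terms
    cancel, as [expi] is 1 at both ends and the values of [A w] there agree. *)
Lemma pearson_form (A B : {poly R[i]}) : pearson w A B ->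
  A.[1] * (w (2 * pi) - w 0)%:C%C = 0 ->
  forall p k, H ('X * A * p^`()) 'X^k = H (('i%C *: B + k%:R *: A) * p) 'X^k.
Proof.
move=> [acA dA] w_boundary p k; have Hf := inner_moment_form.
(* Differentiating in the angle multiplies by ['i X] the derivative of [p], and brings down [- 'i k]
   from the conjugate of [X^k]. *)
pose r := 'i%C *: ('X * p^`() - k%:R *: p).
pose f t := p.[expi t] * ('X^k.[expi t])^*.
pose f' t := r.[expi t] * ('X^k.[expi t])^*.
have df t : is_cderive t f (f' t).
  have := is_cderiveM (is_cderive_horner t p) (is_cderive_conj (is_cderive_horner t 'X^k)).
  congr is_cderive; rewrite /f' /r hornerZ hornerD hornerN hornerM hornerX hornerZ.
  rewrite derivXn hornerMn !hornerXn !(rmorphM, rmorphMn) /= conj_imag.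
  case: k {r f f'} => [|k] /=; first by rewrite mulr0n; ring.
  rewrite -mulr_natl exprS rmorphM /=; ring.
have iA : cintegrable 0 (2 * pi) (fun t => A.[expi t] * (w t)%:C%C).
  by apply: cintegrableM cintegrable_weight => //; exact: ccontinuous_horner.
have iB : cintegrable 0 (2 * pi) (fun t => B.[expi t] * (w t)%:C%C).
  by apply: cintegrableM cintegrable_weight => //; exact: ccontinuous_horner.
have := cintegral_ibp twopi_ge0 acA iA iB dA df (ccontinuous_trig _ _).
rewrite /f expi_0 expi_2pi -mulrBr -mulrBr -rmorphB /= w_boundary mulr0 => ibp.
have : H (r * A + p * B) 'X^k = 0.
  rewrite -[RHS]ibp /inner; congr cintegral; apply/funext => t.
  by rewrite /f' hornerD !hornerM; ring.
(* Since ['i^2 = -1], a nonzero factor ['i] comes out and can be divided away. *)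
have -> : r * A + p * B = 'i%C *: ('X * A * p^`() - ('i%C *: B + k%:R *: A) * p).
  have ii : 'i%C%:P * 'i%C%:P = -1 :> {poly R[i]}.
    rewrite -polyCM -[RHS]polyCN; congr (_%:P).
    by apply/eqP; rewrite eq_complex /= !(mul0r, mulr0, mulr1, sub0r, addr0) oppr0 !eqxx.
  have -> : p * B = - ('i%C%:P * 'i%C%:P) * (p * B) by rewrite ii opprK mul1r.
  by rewrite /r -!mul_polyC; ring.
rewrite (formZ Hf) (formB Hf) => /eqP;
  rewrite mulf_eq0 subr_eq0 => /orP[|/eqP //].
by rewrite eq_complex /= oner_eq0 andbF.
Qed.

End WeightForm.

(** * The differential equation for a weight on the circle *)

Theorem theorem3p8 (R : realType) (A B : {poly R[i]}) (w : R -> R)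
    (Phi : nat -> {poly R[i]}) (n : nat)
    (sizeA : (size A <= 4)%N) (sizeB : (size B <= 4)%N)
    (w_weight : weight_function w)
    (w_pearson : pearson w A B)
    (w_boundary : A.[1] * (w (2 * pi) - w 0)%:C%C = 0)
    (Phi_mops : monic_orthogonal w Phi)
    (n_ge3 : (3 <= n)%N) :
  let Phis := reversed n (Phi n) in
  let Ahat := polyAhat A in
  let U := polyU A B Phi n in
  let V := polyV A B Phi n in
  let W := polyW A B Phi n in
  let Y := polyY A B Phi n in
  let Theta := step W in
  forall z : R[i], z * A.[z] != 0 ->
    Ahat.[z] * (Phis^`()^`()).[z]
    + (Ahat^`().[z] + Y.[z] - Theta * Ahat.[z] * U.[z] * (z * A.[z])^-1)
      * Phis^`().[z]
    + (Theta * (V.[z] * W.[z] - U.[z] * Y.[z]) * (z * A.[z])^-1 + Y^`().[z])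
      * Phis.[z]
    = - (W^`().[z] * (Phi n).[z]).
Proof.
move=> Phis Ahat U V W Y Theta z zA; have [size_Phi monic_Phi orth_Phi] := Phi_mops.
exact: (reversed_ode (inner_moment_form w_weight) size_Phi monic_Phi orth_Phi
  sizeA sizeB (pearson_form w_weight w_pearson w_boundary) n_ge3 zA).
Qed.
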